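(* In the urn framework described in the context, suppose that $R_n=B_n$ for every $n\ge 1$ and $\liminf_n E(B_n)>0$. Then there is a real random variable $Z$ such that $Z_n\to Z$ almost surely, and $Z$ satisfies $L\le Z\le U$ a.s. and $0<Z<1$ a.s.
   Context: Urn framework. Let $b>0$ and $r>0$ be constants (the initial numbers of black and red balls). Let $(\Omega,\mathcal{A},P)$ be a probability space supporting real random variables $L,U$ and $X_n,B_n,R_n$ ($n\ge 1$) such that $0\le L<U\le 1$, $X_n\in\{0,1\}$, and $0\le B_n,R_n\le c$ for all $n$, for some constant $c$. Put $$\mathcal{G}_0=\sigma(L,U),\qquad \mathcal{G}_n=\sigma(L,U,X_1,B_1,R_1,\ldots,X_n,B_n,R_n)\ (n\ge 1),\qquad Z_0=\frac{b}{b+r},$$ and, for $n\ge 1$, recursively $$Z_n=\frac{b+\sum_{i=1}^n X_iB_i I_{\{Z_{i-1}<U\}}}{b+r+\sum_{i=1}^n\bigl[X_iB_iI_{\{Z_{i-1}<U\}}+(1-X_i)R_iI_{\{Z_{i-1}>L\}}\bigr]},$$ where $I_A$ is the indicator of $A$. It is assumed that $E(X_{n+1}\mid\mathcal{G}_n)=Z_n$ a.s. for every $n\ge 0$, and that for every $n\ge 1$ the pair $(B_n,R_n)$ is independent of $\sigma(\mathcal{G}_{n-1},X_n)$. ($X_n$ is the indicator of drawing a black ball at time $n$, $Z_n$ is the proportion of black balls at time $n$, and $L,U$ are random barriers.) *)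

(* Defs.v *)
From HB Require Import structures.
From mathcomp Require Import all_boot all_order all_algebra.
From mathcomp Require Import all_classical all_reals all_analysis.

Set Implicit Arguments.
Unset Strict Implicit.
Unset Printing Implicit Defensive.

Import Order.TTheory GRing.Theory Num.Theory.
Import numFieldNormedType.Exports.

Local Open Scope classical_set_scope.
Local Open Scope ring_scope.

Definition sigma_rv (T : Type) (R : realType) (F : set (T -> R)) :
    set (set T) :=
  <<s \bigcup_(Y in F) preimage_set_system setT Y (@measurable _ R) >>.

Definition sigma_join (T : Type) (F G : set (set T)) : set (set T) :=
  <<s F `|` G >>.

Definition indep_sigma d (T : measurableType d) (R : realType)
    (P : probability T R) (F G : set (set T)) : Prop :=
  forall A C : set T, F A -> G C -> P (A `&` C) = (P A * P C)%E.

(* [Y] is a version of E(X | G); this is the meaning of "E(X | G) = Y a.s.".  *)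
Definition is_cond_exp d (T : measurableType d) (R : realType)
    (P : probability T R) (G : set (set T)) (X Y : T -> R) : Prop :=
  [/\ forall S : set R, measurable S -> G (Y @^-1` S),
      P.-integrable setT (EFin \o Y) &
      forall A : set T, G A ->
        (\int[P]_(w in A) (Y w)%:E = \int[P]_(w in A) (X w)%:E)%E].

(* The sequences are used at the indices n >= 1 only; their terms of index 0  *)
(* play no role.                                                              *)
Definition urn_filtration (T : Type) (R : realType) (L U : T -> R)
    (X B Rd : nat -> T -> R) (n : nat) : set (set T) :=
  sigma_rv ([set L; U] `|`
    \bigcup_(i in [set i | (0 < i <= n)%N]) [set X i; B i; Rd i]).

Definition black_added (T : Type) (R : realType) (U : T -> R)
    (X B Z : nat -> T -> R) (i : nat) (w : T) : R :=
  X i w * B i w * (Z i.-1 w < U w)%R%:R.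

Definition red_added (T : Type) (R : realType) (L : T -> R)
    (X Rd Z : nat -> T -> R) (i : nat) (w : T) : R :=
  (1 - X i w) * Rd i w * (L w < Z i.-1 w)%R%:R.

(* At n = 0 the sums are empty and the equation reads Z_0 = b / (b + r), so   *)
(* Z is uniquely determined by recursion on n.                                *)
Definition urn_proportion (T : Type) (R : realType) (b r : R) (L U : T -> R)
    (X B Rd Z : nat -> T -> R) : Prop :=
  forall (n : nat) (w : T),
    Z n w = (b + \sum_(1 <= i < n.+1) black_added U X B Z i w) /
      (b + r + \sum_(1 <= i < n.+1)
         (black_added U X B Z i w + red_added L X Rd Z i w)).

(* Main.v *)
(* Between the barriers the proportion Z is a martingale; below L it can only  *)
(* increase and above U it can only decrease. The amount B_{n+1} is            *)
(* independent of the past and of the draw, so while the total D_n stays below *)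
(* K every step adds in mean at least a fixed positive amount, whereas all the *)
(* steps made below K add at most K + c; hence D_n tends to infinity almost    *)
(* surely, and the jumps of Z, at most c / D_n, tend to 0. Let M_n be the sum  *)
(* of the increments of Z made strictly between the barriers. Then (M_n -      *)
(* M_k)^2 + c / D_n is a nonnegative supermartingale, and the maximal          *)
(* inequality shows that M is almost surely Cauchy. Along a single path this   *)
(* rules out oscillation of Z inside ]L, U[, while the monotonicity outside    *)
(* forces liminf Z >= L and limsup Z <= U. A limit equal to 0 or 1 would make  *)
(* Z stay strictly between the barriers from some time on; but with x black    *)
(* and y red balls, - ln Z - ln (1 - Z) + c / x + c / y is there a nonnegative *)
(* supermartingale, hence almost surely bounded. All conditional expectations  *)
(* are used in the form E[(X_{n+1} - Z_n) W] = 0 for bounded W depending on    *)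
(* the past and on B_{n+1}.                                                    *)
Require Import Defs.
From HB Require Import structures.
From mathcomp Require Import all_boot all_order all_algebra.
From mathcomp Require Import all_classical all_reals all_analysis.
From mathcomp Require Import measurable_realfun.
From mathcomp Require Import ring lra.
Import Order.TTheory GRing.Theory Num.Theory.
Import numFieldNormedType.Exports.
Local Open Scope classical_set_scope.
Local Open Scope ring_scope.

Set Implicit Arguments.
Unset Strict Implicit.
Unset Printing Implicit Defensive.

(** * Paths with two barriers *)

(** The proof separates a deterministic statement about one path from the almost sure facts that
    feed it. By [barrier_path_cvg] and [urn_path_cvg], a path converges to a limit in [l, u] and in
    ]0, 1[ as soon as the total is unbounded, the sum of the increments of z made strictly between
    the barriers is Cauchy, and the potential is bounded whenever the path finally stays between the
    barriers.

    The total is unbounded by [total_bounded_unlikely]: since L < U, at least one colour can always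
    be added, and while the total is at most K this colour is drawn with conditional probability at
    least min(b, r) / K. The other two facts, [interior_sum_cauchy] and
    [interior_potential_bounded], share one scheme: [square_drift] and [potential_drift] are
    one-step inequalities for a given added amount, [drift_le0] turns them into supermartingale
    inequalities, and [stopped_maximal_inequality] turns these into bounds on probabilities.

    The probabilistic key is [innovation_orthogonal]. Because B_{n+1} is independent of the past and
    the draw jointly, the draw X_{n+1} keeps its conditional mean Z_n even when B_{n+1} is known as
    well; hence the one-step inequalities may be averaged with weights Z_n and 1 - Z_n while the
    amount is held fixed. *)

Section paths.
Context {R : realType}.
Implicit Types (z m : nat -> R) (l u : R).

(** Below [l] the path cannot go down, and a late step from above [l] loses less than [e]; so one
    late visit above [l] is enough. *)
Lemma eventually_above z l e n0 : 0 < e ->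
    (forall n, (n0 <= n)%N -> `|z n.+1 - z n| < e) ->
    (forall n, z n <= l -> z n <= z n.+1) ->
    (exists2 n, (n0 <= n)%N & l < z n) ->
  exists n1, forall n, (n1 <= n)%N -> l - e <= z n.
Proof.
move=> e0 ze zl [n1 n01 lz]; exists n1 => n /subnKC <-.
elim: (n - n1)%N => [|k IH]; first by rewrite addn0; lra.
rewrite addnS; have [/zl zz|lzk] := leP (z (n1 + k)%N) l; first by lra.
have := ze (n1 + k)%N (leq_trans n01 (leq_addr _ _)).
by rewrite ltr_norml; lra.
Qed.

(** Invariant: either z is now at most [a], or since its last visit [p] to that region it has moved
    exactly as [m], whose late oscillation is less than a' - a. *)
Lemma no_late_upcrossing z m l u a a' n0 : l < a -> a < a' -> a' < u ->
    (forall n, (n0 <= n)%N -> `|z n.+1 - z n| < a - l) ->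
    (forall n, l < z n < u -> m n.+1 - m n = z n.+1 - z n) ->
    (forall n p, (n0 <= n)%N -> (n0 <= p)%N -> `|m n - m p| < a' - a) ->
    forall s, (n0 <= s)%N -> z s <= a ->
  forall n, (s <= n)%N -> z n < a'.
Proof.
move=> la aa' a'u ze mz mc s n0s zsa n sn.
suff [|[p [n0p zp zn]]] : z n <= a \/ exists p,
    [/\ (n0 <= p)%N, z p <= a & z n - z p = m n - m p].
- by lra.
- have := mc n p (leq_trans n0s sn) n0p.
  by rewrite -zn ltr_norml; lra.
rewrite -(subnKC sn); elim: (n - s)%N => [|k IH]; first by rewrite addn0; left.
rewrite addnS; set j := (s + k)%N in IH *.
have n0j : (n0 <= j)%N by rewrite (leq_trans n0s) ?leq_addr.
have [|azj] := leP (z j.+1) a; first by left.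
right; have := ze j n0j; rewrite ltr_norml => /andP[_ zj1].
(* The jump is shorter than a - l, so the step that passes above [a] starts above [l]; it is
   therefore a step of [m]. *)
have lzj : l < z j by lra.
have zja' : z j < a'.
  case: IH => [|[p [n0p zp zj]]]; first by lra.
  by have := mc j p n0j n0p; rewrite -zj ltr_norml; lra.
have mj : m j.+1 - m j = z j.+1 - z j by apply: mz; apply/andP; split; lra.
case: IH => [zja|[p [n0p zp zj]]]; first by exists j.
by exists p; split => //; lra.
Qed.

Lemma limn_sup_ltP z x : (forall n, 0 <= z n <= 1) -> limn_sup z < x ->
  exists n0, forall n, (n0 <= n)%N -> z n < x.
Proof.
move=> z01.
have zb : bounded_fun z.
  exists 1; split => // y y1 n _ /=; have /andP[z0 z1] := z01 n.
  by rewrite ger0_norm//; lra.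
rewrite limn_supE// => /inf_lt [|_ [n0 _ <-] sx].
  by exists (sups z 0), 0.
exists n0 => n n0n; apply: le_lt_trans sx; apply: ub_le_sup; last by exists n.
exact/has_ubound_sdrop/bounded_fun_has_ubound.
Qed.

Lemma lt_limn_supP z x n0 : (forall n, 0 <= z n <= 1) -> x < limn_sup z ->
  exists2 n, (n0 <= n)%N & x < z n.
Proof.
move=> z01.
have zb : bounded_fun z.
  exists 1; split => // y y1 n _ /=; have /andP[z0 z1] := z01 n.
  by rewrite ger0_norm//; lra.
rewrite limn_supE// => xs.
have : x < sups z n0.
  apply: (lt_le_trans xs); apply: ge_inf; last by exists n0.
  have [y zy] := bounded_fun_has_lbound zb; exists y => _ [n _ <-].
  apply: le_trans (_ : z n <= _); first by apply: zy; exists n.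
  apply: ub_le_sup; last by exists n => /=.
  exact/has_ubound_sdrop/bounded_fun_has_ubound.
move=> /sup_gt[|_ [n n0n <-] xz]; first by exists (z n0), n0 => /=.
by exists n.
Qed.

(** The monotonicity outside the barriers puts the limsup t in [l, u]. A late visit clearly below t
    would by [no_late_upcrossing] keep z below a level less than t for ever, against the definition
    of t; so the liminf is t as well. *)
Lemma barrier_path_cvg z m l u : l < u ->
    (forall n, 0 <= z n <= 1) ->
    (forall e, 0 < e ->
      exists n0, forall n, (n0 <= n)%N -> `|z n.+1 - z n| < e) ->
    (forall n, z n <= l -> z n <= z n.+1) ->
    (forall n, u <= z n -> z n.+1 <= z n) ->
    (forall n0, exists2 n, (n0 <= n)%N & l < z n) ->
    (forall n0, exists2 n, (n0 <= n)%N & z n < u) ->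
    (forall n, l < z n < u -> m n.+1 - m n = z n.+1 - z n) ->
    (forall e, 0 < e -> exists n0, forall n p, (n0 <= n)%N -> (n0 <= p)%N ->
      `|m n - m p| < e) ->
  z n @[n --> \oo] --> limn_sup z /\ l <= limn_sup z <= u.
Proof.
move=> lu z01 ze zl zu lio uio mz mc; set t := limn_sup z.
have lo e : 0 < e -> exists n0, forall n, (n0 <= n)%N -> l - e < z n.
  move=> e0; have [|n0 zn0] := ze (e / 2); first by lra.
  have [|n1 h] := @eventually_above z l (e / 2) n0 _ zn0 zl (lio n0).
    by lra.
  by exists n1 => n /h; lra.
(* The upper barrier is the lower one for the path -z with barrier -u. *)
have hi e : 0 < e -> exists n0, forall n, (n0 <= n)%N -> z n < u + e.
  move=> e0; have [|n0 zn0] := ze (e / 2); first by lra.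
  have [|n n0n|n||n1 h] := @eventually_above (\- z) (- u) (e / 2) n0.
  - by lra.
  - by rewrite /= -opprD normrN zn0.
  - by rewrite /= !lerN2; exact: zu.
  - by have [n n0n zn] := uio n0; exists n => //=; rewrite ltrN2.
  - by exists n1 => n /h/=; lra.
have lt : l <= t.
  rewrite leNgt; apply/negP => tl.
  have [n0 h0] : exists n0, forall n, (n0 <= n)%N -> z n < (t + l) / 2.
    by apply: limn_sup_ltP => //; rewrite -/t; lra.
  have [|n1 h1] := lo ((l - t) / 2); first by lra.
  have := h0 _ (leq_maxl n0 n1); have := h1 _ (leq_maxr n0 n1); lra.
have tu : t <= u.
  rewrite leNgt; apply/negP => ut.
  have [|n0 h0] := hi ((t - u) / 2); first by lra.
  have [] := @lt_limn_supP z ((t + u) / 2) n0 z01; first by rewrite -/t; lra.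
  by move=> n /h0; lra.
split; last by rewrite lt tu.
have below e : 0 < e -> exists n0, forall n, (n0 <= n)%N -> t - e < z n.
  move=> e0; have [tl|lt'] := leP t l.
    by have [n0 h0] := lo e e0; exists n0 => n /h0; lra.
  (* A level in ]l, t[ that is also above t - e; the level a' is then halfway between it and t. *)
  pose a := Num.max ((l + t) / 2) (t - e / 2).
  have la : l < a by rewrite lt_max; apply/orP; left; lra.
  have at_ : a < t by rewrite gt_max; apply/andP; split; lra.
  have ea : t - e < a by rewrite lt_max; apply/orP; right; lra.
  pose a' := (a + t) / 2.
  have [|n0 zn0] := ze (a - l); first by lra.
  have [|n1 mn1] := mc (a' - a); first by rewrite /a'; lra.
  exists (maxn n0 n1) => n; rewrite geq_max => /andP[n0n n1n].
  rewrite ltNge; apply/negP => zn.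
  have [] := @lt_limn_supP z a' n z01; first by rewrite -/t /a'; lra.
  move=> p np; rewrite ltNge => /negP; apply; apply: ltW.
  apply: (@no_late_upcrossing z m l u a a' (maxn n0 n1) la _ _ _ mz _ n) => //.
  - by rewrite /a'; lra.
  - by rewrite /a'; lra.
  - by move=> k; rewrite geq_max => /andP[? _]; exact: zn0.
  - by move=> k q; rewrite !geq_max => /andP[_ ?] /andP[_ ?]; exact: mn1.
  - by rewrite geq_max n0n.
  - by lra.
apply/cvgrPdist_lt => e e0.
have [n0 h0] := below e e0.
have [n1 h1] : exists n1, forall n, (n1 <= n)%N -> z n < t + e.
  by apply: limn_sup_ltP => //; rewrite -/t; lra.
exists (maxn n0 n1) => // n /=; rewrite geq_max => /andP[/h0 ? /h1 ?].
by rewrite ltr_norml; lra.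
Qed.

End paths.

(** * One-step inequalities for the two supermartingales *)

Section potential.
Context {R : realType}.
Implicit Types (x y c t : R).

(** With z = x / (x + y), the logarithms are - ln z and - ln (1 - z). As logarithms of ratios that
    are at least 1 they are visibly nonnegative, and [bmfun_ln] applies to them. *)
Definition potential c x y : R :=
  ln ((x + y) / x) + ln ((x + y) / y) + c / x + c / y.

Lemma potential_ge c x y : 0 <= c -> 0 < x -> 0 < y ->
  0 <= ln ((x + y) / x) <= potential c x y /\
  0 <= ln ((x + y) / y) <= potential c x y.
Proof.
move=> c0 x0 y0.
have h1 : 0 <= ln ((x + y) / x) by rewrite ln_ge0// ler_pdivlMr//; lra.
have h2 : 0 <= ln ((x + y) / y) by rewrite ln_ge0// ler_pdivlMr//; lra.
have := divr_ge0 c0 (ltW x0); have := divr_ge0 c0 (ltW y0).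
by rewrite /potential => ? ?; split; apply/andP; split => //; lra.
Qed.

Lemma ln_ratio_le x t : 0 < x -> 0 <= t -> ln (x + t) - ln x <= t / x.
Proof.
move=> x0 t0; have tx : 0 <= t / x by rewrite divr_ge0// ltW.
have -> : ln (x + t) = ln (x * (1 + t / x)).
  by congr ln; field; rewrite gt_eqF.
rewrite lnM ?posrE//; last by lra.
by rewrite [ln x + _]addrC addrK le_ln1Dx//; lra.
Qed.

Lemma ln_ratio_ge x t : 0 < x -> 0 <= t -> t / (x + t) <= ln (x + t) - ln x.
Proof.
move=> x0 t0; have xt0 : 0 < x + t by lra.
have -> : ln x = ln ((x + t) * (1 + - (t / (x + t)))).
  by congr ln; field; rewrite gt_eqF.
have tx : t / (x + t) < 1 by rewrite ltr_pdivrMr//; lra.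
rewrite lnM ?posrE//; last by lra.
have : ln (1 + - (t / (x + t))) <= - (t / (x + t)) by rewrite le_ln1Dx//; lra.
by lra.
Qed.

(* The [c / x] and [c / y] terms absorb the second-order terms produced by the *)
(* concavity of the logarithm.                                                 *)
Lemma potential_drift c x y t : 0 < x -> 0 < y -> 0 <= t <= c ->
  x / (x + y) * potential c (x + t) y + y / (x + y) * potential c x (y + t)
    <= potential c x y.
Proof.
move=> x0 y0 /andP[t0 tc].
have D0 : 0 < x + y by lra.
have xt0 : 0 < x + t by lra.
have yt0 : 0 < y + t by lra.
have potE x' y' : 0 < x' -> 0 < y' ->
    potential c x' y' = 2 * ln (x' + y') - ln x' - ln y' + c / x' + c / y'.
  by move=> ? ?; rewrite /potential !ln_div ?posrE//; [ring|lra|lra].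
rewrite !potE//.
have -> : x + t + y = x + y + t by ring.
have -> : x + (y + t) = x + y + t by ring.
have hD := ln_ratio_le D0 t0.
have hx := ln_ratio_ge x0 t0.
have hy := ln_ratio_ge y0 t0.
set p := x / (x + y); set q := y / (x + y).
have p0 : 0 <= p by rewrite divr_ge0 ?ltW.
have q0 : 0 <= q by rewrite divr_ge0 ?ltW.
have q1 : q = 1 - p by rewrite /p /q; field; rewrite gt_eqF.
have hx' : p * (t / (x + t)) <= p * (ln (x + t) - ln x) by rewrite ler_wpM2l.
have hy' : q * (t / (y + t)) <= q * (ln (y + t) - ln y) by rewrite ler_wpM2l.
(* What c / x loses, weighted by p, dominates the second-order error t * t / (x + y) / (x + t),
   because t <= c. The first-order terms cancel: 2 t / (x + y) against t / (x + y) from each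
   colour. *)
have Ex : p * (c / x - c / (x + t)) = c * t / (x + y) / (x + t).
  by rewrite /p; field; rewrite !gt_eqF.
have Ey : q * (c / y - c / (y + t)) = c * t / (x + y) / (y + t).
  by rewrite /q; field; rewrite !gt_eqF.
have Fx : p * (t / (x + t)) = t / (x + y) - t * t / (x + y) / (x + t).
  by rewrite /p; field; rewrite !gt_eqF.
have Fy : q * (t / (y + t)) = t / (x + y) - t * t / (x + y) / (y + t).
  by rewrite /q; field; rewrite !gt_eqF.
have tt : t * t <= c * t by rewrite ler_wpM2r.
have Gx : t * t / (x + y) / (x + t) <= c * t / (x + y) / (x + t).
  by rewrite !ler_wpM2r// invr_ge0 ltW.
have Gy : t * t / (x + y) / (y + t) <= c * t / (x + y) / (y + t).
  by rewrite !ler_wpM2r// invr_ge0 ltW.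
move: hD hx' hy' Ex Ey Fx Fy Gx Gy; rewrite q1.
move: (t / (x + y)) (c * t / (x + y) / (x + t)) (c * t / (x + y) / (y + t)).
move: (t * t / (x + y) / (x + t)) (t * t / (x + y) / (y + t)).
move: (c / x) (c / y) (c / (x + t)) (c / (y + t)) (t / (x + t)) (t / (y + t)).
move: (ln _) (ln _) (ln _) (ln _) (ln _) (ln _) => l1 l2 l3 l4 l5 l6.
by move=> *; lra.
Qed.

(** The square gains the variance p (1 - p) s^2 with s = t / (D + t), while c / D loses exactly (c /
    D) s; and s <= c / D. *)
Lemma square_drift c D t m p : 0 < D -> 0 <= t <= c -> 0 <= p <= 1 ->
  p * ((m + (1 - p) * (t / (D + t))) ^+ 2 + c / (D + t)) +
  (1 - p) * ((m - p * (t / (D + t))) ^+ 2 + c / (D + t)) <= m ^+ 2 + c / D.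
Proof.
move=> D0 /andP[t0 tc] /andP[p0 p1].
have Dt0 : 0 < D + t by lra.
set s := t / (D + t).
have s0 : 0 <= s by rewrite divr_ge0// ltW.
have sE : s = 1 - D / (D + t) by rewrite /s; field; rewrite gt_eqF.
have -> : p * ((m + (1 - p) * s) ^+ 2 + c / (D + t)) +
    (1 - p) * ((m - p * s) ^+ 2 + c / (D + t)) =
    m ^+ 2 + p * (1 - p) * s ^+ 2 + c / (D + t) by ring.
have -> : c / D = c / (D + t) + c / D * s.
  by rewrite /s; field; rewrite !gt_eqF.
have sc : s <= c / D.
  rewrite ler_pM//; [by rewrite invr_ge0 ltW|].
  by rewrite lef_pV2 ?posrE//; lra.
have : s ^+ 2 <= c / D * s by rewrite expr2 ler_wpM2r.
have : p * (1 - p) * s ^+ 2 <= s ^+ 2.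
  by rewrite ler_piMl ?sqr_ge0//; nra.
by lra.
Qed.

End potential.

(** * Bounded functions measurable for a sub-sigma-algebra *)

Section bounded_measurable.
Context {d : measure_display} {T : measurableType d} {R : realType}.
Implicit Types (C : set (set T)) (f g : T -> R) (A : set T).

(** [C] is only a generating family; measurability refers to [<<s C >>]. The bound keeps the class
    closed under products and makes every member integrable once [<<s C >>] consists of measurable
    sets. *)
Definition bmfun C f : Prop :=
  @measurable_fun _ _ (g_sigma_algebraType C) R setT f /\
  exists K, forall w, `|f w| <= K.

Lemma bmfun_cst C r : bmfun C (fun=> r).
Proof. by split; [exact: measurable_cst|exists `|r|]. Qed.

Lemma bmfunD C f g : bmfun C f -> bmfun C g -> bmfun C (fun w => f w + g w).
Proof.
move=> [mf [K fK]] [mg [K' gK']]; split; first exact: measurable_funD.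
by exists (K + K') => w; apply: (le_trans (ler_normD _ _)); exact: lerD.
Qed.

Lemma bmfunN C f : bmfun C f -> bmfun C (fun w => - f w).
Proof.
move=> [mf [K fK]]; split; first exact: measurable_funN.
by exists K => w; rewrite normrN.
Qed.

Lemma bmfunB C f g : bmfun C f -> bmfun C g -> bmfun C (fun w => f w - g w).
Proof. by move=> ? ?; apply: bmfunD => //; exact: bmfunN. Qed.

Lemma bmfunM C f g : bmfun C f -> bmfun C g -> bmfun C (fun w => f w * g w).
Proof.
move=> [mf [K fK]] [mg [K' gK']]; split; first exact: measurable_funM.
by exists (K * K') => w; rewrite normrM ler_pM.
Qed.

Lemma bmfun_sum C (F : nat -> T -> R) m n :
  (forall i, (m <= i < n)%N -> bmfun C (F i)) ->
  bmfun C (fun w => \sum_(m <= i < n) F i w).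
Proof.
elim: n => [|n IH] mF.
  by under eq_fun do rewrite big_geq//; exact: bmfun_cst.
have [mn|nm] := leqP m n; last first.
  by under eq_fun do rewrite big_geq//; exact: bmfun_cst.
under eq_fun do rewrite big_nat_recr//=.
apply: bmfunD; last by apply: mF; rewrite mn ltnSn.
by apply: IH => i /andP[mi ni]; apply: mF; rewrite mi ltnS ltnW.
Qed.

Lemma bmfun_indic C A : <<s C >> A -> bmfun C (\1_A).
Proof.
move=> CA; split; first exact: (@measurable_indic _ (g_sigma_algebraType C)).
by exists 1 => w; rewrite indicE; case: (_ \in _); rewrite ?normr1 ?normr0.
Qed.

Lemma bmfunV C f e : 0 < e -> (forall w, e <= f w) -> bmfun C f ->
  bmfun C (fun w => (f w)^-1).
Proof.
move=> e0 ef [mf _]; split; last first.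
  exists e^-1 => w; have fw0 : 0 < f w by rewrite (lt_le_trans e0).
  by rewrite normfV gtr0_norm// lef_pV2.
have -> : (fun w => (f w)^-1) = (fun x => x `^ (- 1)) \o f.
  apply/funext => w /=; rewrite powR_inv1//.
  by rewrite ltW// (lt_le_trans e0).
by apply: measurableT_comp mf => //; exact: measurable_powR.
Qed.

Lemma bmfun_ln C f : (forall w, 1 <= f w) -> bmfun C f ->
  bmfun C (fun w => ln (f w)).
Proof.
move=> f1 [mf [K fK]]; split.
  by apply: measurableT_comp mf => //; exact: measurable_ln.
exists K => w; rewrite ger0_norm ?ln_ge0//.
apply: le_trans (fK w); rewrite (le_trans (ltW (ln_sublinear _))) ?ler_norm//.
exact: lt_le_trans (f1 w).
Qed.

Lemma bmfunS C C' f : <<s C >> `<=` <<s C' >> -> bmfun C f -> bmfun C' f.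
Proof.
move=> CC' [mf bf]; split => // _ Y mY.
by apply: CC'; exact: mf.
Qed.

Lemma bmfun_lt C f g : bmfun C f -> bmfun C g -> <<s C >> [set w | f w < g w].
Proof.
move=> [mf _] [mg _].
have := measurable_fun_ltr mf mg measurableT (Y := [set true]).
by rewrite setTI; exact.
Qed.

Lemma bmfun_natlt C f g : bmfun C f -> bmfun C g ->
  bmfun C (fun w => (f w < g w)%R%:R : R).
Proof.
move=> bf bg; have := bmfun_indic (bmfun_lt bf bg); congr bmfun.
apply/funext => w; rewrite indicE; congr (_%:R); congr nat_of_bool.
by apply/idP/idP; rewrite inE.
Qed.

Lemma bmfun_le C f g : bmfun C f -> bmfun C g -> <<s C >> [set w | f w <= g w].
Proof.
move=> [mf _] [mg _].
have := measurable_fun_ler mf mg measurableT (Y := [set true]).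
by rewrite setTI; exact.
Qed.

Lemma g_sigma_measurable : <<s @measurable d T >> = @measurable d T.
Proof. exact: (sigma_algebra_id (@sigma_algebra_measurable _ _)). Qed.

End bounded_measurable.

(** * Expectations of bounded functions, and orthogonality from indicators to functions *)

Section expectation_bounded.
Context {d : measure_display} {T : measurableType d} {R : realType}.
Variable P : probability T R.
Implicit Types (C : set (set T)) (f g W : T -> R) (A : set T).
Local Notation Ex := (Rintegral P setT).
Local Notation bM := (bmfun (@measurable d T)).

Lemma bmfun_integrable f : bM f -> P.-integrable setT (EFin \o f).
Proof.
move=> [mf [K fK]].
apply: measurable_bounded_integrable => //.
- by rewrite (le_lt_trans (probability_le1 P measurableT))// ltry.
- by move=> _ Y mY; rewrite -g_sigma_measurable; exact: mf.
- exists K; split; first exact: num_real.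
  by move=> y Ky w _ /=; rewrite (le_trans (fK w))// ltW.
Qed.

Lemma ExD f g : bM f -> bM g -> Ex (fun w => f w + g w) = Ex f + Ex g.
Proof. by move=> bf bg; rewrite RintegralD//; exact: bmfun_integrable. Qed.

Lemma ExB f g : bM f -> bM g -> Ex (fun w => f w - g w) = Ex f - Ex g.
Proof. by move=> bf bg; rewrite RintegralB//; exact: bmfun_integrable. Qed.

Lemma ExZ r f : bM f -> Ex (fun w => r * f w) = r * Ex f.
Proof. by move=> bf; rewrite RintegralZl//; exact: bmfun_integrable. Qed.

Lemma Ex_cst r : Ex (fun=> r) = r.
Proof.
transitivity (r * fine (P setT)); first exact: Rintegral_cst.
by rewrite probability_setT mulr1.
Qed.

Lemma le_Ex f g : bM f -> bM g -> (forall w, f w <= g w) -> Ex f <= Ex g.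
Proof. by move=> ? ? fg; apply: le_Rintegral => //; exact: bmfun_integrable. Qed.

Lemma Ex_indic A : measurable A -> Ex (\1_A) = fine (P A).
Proof. by move=> mA; rewrite /Rintegral integral_indic// setIT. Qed.

Lemma bM_indic A : measurable A -> bM (\1_A : T -> R).
Proof. by move=> mA; apply: bmfun_indic; rewrite g_sigma_measurable. Qed.

Lemma RintegralE_indic A f :
  \int[P]_(w in A) f w = Ex (fun w => f w * \1_A w).
Proof.
rewrite Rintegral_mkcond; apply: eq_Rintegral => w _.
by rewrite patchE indicE; case: ifP; rewrite ?mulr1 ?mulr0.
Qed.

Lemma Ex_sum (F : nat -> T -> R) m n :
  (forall i, (m <= i < n)%N -> bM (F i)) ->
  Ex (fun w => \sum_(m <= i < n) F i w) = \sum_(m <= i < n) Ex (F i).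
Proof.
elim: n => [|n IH] mF.
  rewrite big_geq//; under eq_Rintegral do rewrite big_geq//.
  exact: Ex_cst.
have [mn|nm] := leqP m n; last first.
  rewrite big_geq//; under eq_Rintegral do rewrite big_geq//.
  exact: Ex_cst.
have mF' i : (m <= i < n)%N -> bM (F i).
  by move=> /andP[mi ni]; apply: mF; rewrite mi ltnS ltnW.
rewrite big_nat_recr//= -IH//.
under eq_Rintegral do rewrite big_nat_recr//=.
by rewrite ExD//; [exact: bmfun_sum|apply: mF; rewrite mn ltnSn].
Qed.

Lemma norm_Ex_le f K : bM f -> (forall w, `|f w| <= K) -> `|Ex f| <= K.
Proof.
move=> bf fK; rewrite ler_norml -[X in X <= _]Ex_cst -[X in _ && (_ <= X)]Ex_cst.
apply/andP; split; apply: le_Ex => //; try exact: bmfun_cst.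
- by move=> w; have := fK w; rewrite ler_norml => /andP[].
- by move=> w; have := fK w; rewrite ler_norml => /andP[].
Qed.

(** The sum counts the integers from 1 to M that are at most x: the integer part of x, truncated at
    M. *)
Lemma sum_levels (x : R) M : 0 <= x ->
  let S : R := \sum_(1 <= k < M.+1) (k%:R <= x)%R%:R in
  if M%:R <= x then S = M%:R else x - 1 <= S <= x.
Proof.
move=> x0 /=; elim: M => [|M IH]; first by rewrite x0 big_geq.
rewrite big_nat_recr//=; have [Mx|xM] := leP M.+1%:R x.
  move: IH; rewrite (le_trans _ Mx) ?ler_nat// => ->.
  by rewrite -natr1.
rewrite addr0; move: IH; case: ifPn => [Mx ->|_ //].
by rewrite Mx andbT; move: xM; rewrite -natr1; lra.
Qed.

(* Layer-cake approximation: [W] is uniformly within [1 / N] of an average of  *)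
(* indicators of its superlevel sets.                                          *)
Lemma orthogonal_indic_bmfun C (eta W : T -> R) :
  <<s C >> `<=` measurable -> bM eta ->
  (forall A, <<s C >> A -> Ex (fun w => eta w * \1_A w) = 0) ->
  bmfun C W -> Ex (fun w => eta w * W w) = 0.
Proof.
move=> Cm be eta0.
have CM f : bmfun C f -> bM f.
  by apply: bmfunS; rewrite g_sigma_measurable.
suff pos V : bmfun C V -> (forall w, 0 <= V w) -> Ex (fun w => eta w * V w) = 0.
  move=> bW; have [_ [K WK]] := bW.
  have bK : bmfun C (fun=> K) by exact: bmfun_cst.
  have -> : Ex (fun w => eta w * W w) = Ex (fun w => eta w * (W w + K)) -
      Ex (fun w => eta w * K).
    rewrite -ExB; last 2 first.
    - by apply: bmfunM => //; apply: CM; exact: bmfunD.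
    - by apply: bmfunM => //; exact: CM.
    by apply: eq_Rintegral => w _; ring.
  rewrite (pos (fun w => W w + K)); last 2 first.
  - exact: bmfunD.
  - by move=> w; have := WK w; rewrite ler_norml; lra.
  by rewrite (pos (fun=> K)) ?subrr// => w; rewrite (le_trans _ (WK w)).
move=> bV V0; have [_ [K etaK]] := be; have [_ [KV VKV]] := bV.
apply/eqP; rewrite -normr_le0; apply/ler_addgt0Pl => e e0; rewrite addr0.
have K0 : 0 <= K by rewrite (le_trans _ (etaK point)).
have KV0 : 0 <= KV by rewrite (le_trans _ (VKV point)).
(* This makes K / N < e, where K / N is the error of the approximation of V by levels of mesh 1 /
   N. *)
pose N := (Num.truncn (K / e)).+1.
have KN : K / e < N%:R by exact: truncnS_gt.
(* M exceeds all values of N * V, so the truncated case of [sum_levels] never occurs. *)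
pose M := (Num.truncn (N%:R * KV)).+1.
have NM : N%:R * KV < M%:R by exact: truncnS_gt.
have N0 : 0 < N%:R :> R by rewrite ltr0n.
pose A k := [set w | k%:R <= N%:R * V w].
have CA k : <<s C >> (A k).
  apply: bmfun_le; first exact: bmfun_cst.
  by apply: bmfunM => //; exact: bmfun_cst.
pose S w : R := \sum_(1 <= k < M.+1) \1_(A k) w.
have bS : bmfun C S by apply: bmfun_sum => i _; exact: bmfun_indic.
have ES : Ex (fun w => eta w * S w) = 0.
  rewrite (_ : Ex _ = Ex (fun w => \sum_(1 <= k < M.+1) eta w * \1_(A k) w)).
    rewrite Ex_sum => [|i _]; last first.
      by apply: bmfunM => //; apply: CM; exact: bmfun_indic.
    by rewrite big1_seq// => i _; rewrite eta0.
  by apply: eq_Rintegral => w _; rewrite /S big_distrr.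
have SV w : `|V w - N%:R^-1 * S w| <= N%:R^-1.
  have := @sum_levels (N%:R * V w) M (mulr_ge0 (ltW N0) (V0 w)).
  rewrite /= leNgt (le_lt_trans _ NM)/=; last first.
    by rewrite ler_pM2l// (le_trans (ler_norm _)).
  have -> : \sum_(1 <= k < M.+1) (k%:R <= N%:R * V w)%R%:R = S w.
    rewrite /S; apply: eq_bigr => k _; rewrite indicE /A.
    by congr (_%:R); congr nat_of_bool; apply/idP/idP; rewrite inE.
  move=> NS.
  have -> : V w - N%:R^-1 * S w = N%:R^-1 * (N%:R * V w - S w).
    by field; rewrite gt_eqF.
  rewrite normrM gtr0_norm ?invr_gt0//.
  apply: ler_piMr; first by rewrite invr_ge0 ltW.
  by rewrite ler_norml; lra.
have bc : bM (fun=> N%:R^-1) := bmfun_cst _ _.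
have -> : Ex (fun w => eta w * V w) = Ex (fun w => eta w * (V w - N%:R^-1 * S w)).
  rewrite -[RHS](addr0) -[X in _ + X](mulr0 N%:R^-1) -ES -ExZ; last first.
    by apply: bmfunM => //; exact: CM.
  rewrite -ExD.
  - by apply: eq_Rintegral => w _; ring.
  - apply: bmfunM => //; apply: bmfunB; first exact: CM.
    by apply: bmfunM => //; exact: CM.
  - by apply: bmfunM => //; apply: bmfunM => //; exact: CM.
apply: norm_Ex_le => [|w].
  apply: bmfunM => //; apply: bmfunB; first exact: CM.
  by apply: bmfunM => //; exact: CM.
rewrite normrM; apply: (@le_trans _ _ (K * N%:R^-1)); first exact: ler_pM.
by rewrite ler_pdivrMr// mulrC -ler_pdivrMr// ltW.
Qed.

End expectation_bounded.

(** * The maximal inequality *)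

Section maximal.
Context {d : measure_display} {T : measurableType d} {R : realType}.
Variable P : probability T R.
Implicit Types (C : set (set T)) (f g : T -> R) (A : set T).
Local Notation Ex := (Rintegral P setT).
Local Notation bM := (bmfun (@measurable d T)).

(** Small measurable covers spare a proof that the exceptional sets met below are themselves
    measurable. *)
Lemma negligible_eps A :
  (forall e, 0 < e -> exists2 B, measurable B & A `<=` B /\ (P B <= e%:E)%E) ->
  P.-negligible A.
Proof.
move=> h.
have /choice[B hB] : forall n : nat, exists B,
    [/\ measurable B, A `<=` B & (P B <= n.+1%:R^-1%:E)%E].
  by move=> n; have [|B mB [AB PB]] := h n.+1%:R^-1; [rewrite invr_gt0|exists B].
have mB : measurable (\bigcap_n B n).
  by apply: bigcapT_measurable => n; have [] := hB n.
exists (\bigcap_n B n); split => //; last first.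
  by move=> w Aw n _; have [_ AB _] := hB n; exact: AB.
have PBn n : (P (\bigcap_n B n) <= n.+1%:R^-1%:E)%E.
  have [mBn _ PB] := hB n; apply: le_trans PB.
  by apply: le_measure; rewrite ?inE//; exact: bigcap_inf.
apply/eqP; rewrite eq_le measure_ge0 andbT; apply/lee_addgt0Pr => e e0.
rewrite add0e; apply: le_trans (PBn (Num.truncn e^-1)) _.
rewrite lee_fin -[leRHS]invrK lef_pV2 ?posrE ?invr_gt0// ltW//.
exact: truncnS_gt.
Qed.

(** The sum telescopes to y i, where i is the first index at which [q] fails or y reaches e, capped
    at j. If y reaches e while [q] has held so far, then i is that hitting index. *)
Lemma stopped_sum_ge (y : nat -> R) (q : nat -> Prop) e :
  (forall n, 0 <= y n) -> 0 < e ->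
  forall (s : nat -> bool),
    (forall j, s j <-> forall i, (i <= j)%N -> q i /\ y i < e) ->
  forall j, let S := y 0%N + \sum_(0 <= i < j) (s i)%:R * (y i.+1 - y i) in
  0 <= S /\
  ((exists2 n, (n <= j)%N & e <= y n /\ forall i, (i < n)%N -> q i) -> e <= S).
Proof.
move=> y0 e0 s sP j /=.
suff [i [ij -> gi bi]] : exists i, [/\ (i <= j)%N,
    y 0%N + \sum_(0 <= i < j) (s i)%:R * (y i.+1 - y i) = y i,
    forall l, (l < i)%N -> q l /\ y l < e &
    i = j \/ ~ (q i /\ y i < e)].
  split=> // -[n nj [eyn qn]].
  have ni : (i <= n)%N.
    by rewrite leqNgt; apply/negP => /gi[_]; rewrite ltNge eyn.
  case: bi => [ij'|ni'].
    suff -> : i = n by [].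
    by apply/eqP; rewrite eqn_leq ni ij'.
  move: ni; rewrite leq_eqVlt => /predU1P[->//|/qn qi].
  by rewrite leNgt; apply/negP => yi; apply: ni'.
elim: j => [|j [i [ij IH gi bi]]].
  by exists 0%N; rewrite big_geq// addr0; split => //; left.
rewrite big_nat_recr//= addrA IH.
have [sj|sj] := boolP (s j).
- have sj' := (sP j).1 sj.
  exists j.+1; split => //; last by left.
  case: bi => [->|]; first by rewrite mul1r addrC subrK.
  by move/(_ (sj' i ij)).
- exists i; rewrite mul0r addr0; split => //; first by rewrite ltnW.
  right => ngi; move/negP: sj; apply; apply/sP => l lj.
  case: bi => // ij'; move: lj; rewrite -ij' leq_eqVlt => /predU1P[->//|].
  exact: gi.
Qed.

(** Y is a supermartingale only on [Q]. Stopped on leaving [Q] or on reaching e, it has mean at most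
    E(Y_0), is nonnegative, and is at least e where the level was reached in time; Markov's
    inequality concludes. *)
Lemma stopped_maximal_inequality (G : nat -> set (set T)) (Q : nat -> set T)
    (Y : nat -> T -> R) (e : R) : 0 < e ->
  (forall n, <<s G n >> `<=` measurable) ->
  (forall n, <<s G n >> `<=` <<s G n.+1 >>) ->
  (forall n, bmfun (G n) (Y n)) -> (forall n w, 0 <= Y n w) ->
  (forall n, <<s G n >> (Q n)) ->
  (forall n A, <<s G n >> A -> A `<=` Q n ->
    Ex (fun w => \1_A w * (Y n.+1 w - Y n w)) <= 0) ->
  exists2 E, measurable E &
    (forall w n, e <= Y n w -> (forall i, (i < n)%N -> Q i w) -> E w) /\
    (P E <= (Ex (Y 0%N) / e)%:E)%E.
Proof.
move=> e0 Gm GS bY Y0 GQ drift.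
pose E := [set w | exists2 n, e <= Y n w & forall i, (i < n)%N -> Q i w].
have GM n f : bmfun (G n) f -> bM f.
  by apply: bmfunS; rewrite g_sigma_measurable.
have Gle i j : (i <= j)%N -> <<s G i >> `<=` <<s G j >>.
  move/subnK <-; elim: (j - i)%N => // k IH; rewrite addSn.
  by apply: subset_trans IH _; exact: GS.
have GI C (A B : set T) : <<s C >> A -> <<s C >> B -> <<s C >> (A `&` B).
  exact: (@measurableI _ (g_sigma_algebraType C)).
(* The event of not being stopped up to time n. It is in [<<s G n >>] and inside [Q n], as [drift]
   requires. *)
pose F n := [set w | forall i, (i <= n)%N -> Q i w /\ Y i w < e].
have GF n : <<s G n >> (F n).
  have -> : F n = \bigcap_(i in [set i | (i <= n)%N]) (Q i `&` [set w | Y i w < e]).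
    by apply/seteqP; split => w /= h i /= /h.
  apply: (@bigcap_measurable _ (g_sigma_algebraType (G n))); first by exists 0%N.
  move=> i /= ni; apply: (Gle i n ni); apply: GI => //.
  by apply: bmfun_lt => //; exact: bmfun_cst.
pose D i w := \1_(F i) w * (Y i.+1 w - Y i w).
have bD i : bM (D i).
  apply: bmfunM; first by apply: (GM i); exact: bmfun_indic.
  by apply: bmfunB; [exact: (GM i.+1)|exact: (GM i)].
pose S j w := Y 0%N w + \sum_(0 <= i < j) D i w.
have bS j : bM (S j).
  by apply: bmfunD; [exact: (GM 0%N)|exact: bmfun_sum].
have ES j : Ex (S j) <= Ex (Y 0%N).
  rewrite ExD//; [|exact: (GM 0%N)|exact: bmfun_sum].
  rewrite Ex_sum// gerDl; apply: sumr_le0 => i _; apply: drift => //.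
  by move=> w /(_ i (leqnn i))[].
pose E_ j := [set w | exists2 n, (n <= j)%N &
  e <= Y n w /\ forall i, (i < n)%N -> Q i w].
have mE_ j : measurable (E_ j).
  have -> : E_ j = \bigcup_(n in [set n | (n <= j)%N])
      ([set w | e <= Y n w] `&` \bigcap_(i in [set i | (i < n)%N]) Q i).
    by apply/seteqP; split => w /= [n nj h]; exists n.
  apply: bigcup_measurable => n _; apply: measurableI.
    by apply: (Gm n); apply: bmfun_le => //; exact: bmfun_cst.
  apply: bigcap_measurableType => i _; exact: Gm.
have PE_ j : (P (E_ j) <= (Ex (Y 0%N) / e)%:E)%E.
  have -> : P (E_ j) = (fine (P (E_ j)))%:E.
    by rewrite fineK// fin_num_measure.
  rewrite lee_fin ler_pdivlMr// mulrC -Ex_indic//.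
  apply: le_trans (ES j).
  have bE := @bM_indic _ _ R _ (mE_ j).
  rewrite -ExZ//; apply: le_Ex => // [|w].
    by apply: bmfunM => //; exact: bmfun_cst.
  have [] := @stopped_sum_ge (Y ^~ w) (Q ^~ w) e (fun n => Y0 n w) e0
    (fun i => w \in F i) _ j.
    by move=> i; split; rewrite inE.
  rewrite -/(S j w) => S0 Se; rewrite indicE.
  have [|_] := boolP (w \in E_ j); last by rewrite mulr0.
  by rewrite inE mulr1; exact: Se.
have EE : E = \bigcup_j E_ j.
  apply/seteqP; split => w /= [n h].
    by move=> h'; exists n => //; exists n.
  by case=> n' _ [? ?]; exists n'.
have mE : measurable E by rewrite EE; exact: bigcup_measurable.
exists E => //; split; first by move=> w n ? ?; exists n.
(* The bound is uniform in the horizon j, and the events [E_ j] increase to [E]. *)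
rewrite EE; have cv : P (E_ j) @[j --> \oo] --> P (\bigcup_j E_ j).
  apply: nondecreasing_cvg_mu => //; first by rewrite -EE.
  move=> i j ij; apply/subsetPset => w [n ni h]; exists n => //.
  exact: leq_trans ni ij.
rewrite -(cvg_lim _ cv)//; apply: lime_le; first by apply/cvg_ex; eexists; exact: cv.
exact: nearW.
Qed.

End maximal.

(** * Paths of the urn *)

Section urn_paths.
Context {R : realType}.
Variables (c l u : R) (x y : nat -> R).
Hypotheses (c0 : 0 <= c) (l0 : 0 <= l) (lu : l < u) (u1 : u <= 1).
Hypotheses (x0 : 0 < x 0%N) (y0 : 0 < y 0%N).
Let D n := x n + y n.
Let z n := x n / D n.
Hypothesis step : forall n, exists2 t : R, 0 <= t <= c &
  (x n.+1 = x n + t * (z n < u)%R%:R /\ y n.+1 = y n) \/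
  (x n.+1 = x n /\ y n.+1 = y n + t * (l < z n)%R%:R).

Lemma path_nondecreasing n : x n <= x n.+1 /\ y n <= y n.+1.
Proof.
have [t /andP[t0 _] [[-> ->]|[-> ->]]] := step n.
  by split=> //; rewrite lerDl mulr_ge0.
by split=> //; rewrite lerDl mulr_ge0.
Qed.

Lemma path_ge i n : (i <= n)%N -> x i <= x n /\ y i <= y n.
Proof.
move/subnK <-; elim: (n - i)%N => // k [xk yk]; rewrite addSn.
have [? ?] := path_nondecreasing (k + i).
by split; [exact: le_trans xk _|exact: le_trans yk _].
Qed.

Lemma path_gt0 n : 0 < x n /\ 0 < y n.
Proof.
have [xn yn] := path_ge (leq0n n).
by split; [exact: lt_le_trans xn|exact: lt_le_trans yn].
Qed.

Let D0 n : 0 < D n.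
Proof. by rewrite /D; have [? ?] := path_gt0 n; lra. Qed.

Lemma path_proportion_itv n : 0 < z n < 1.
Proof.
have [? ?] := path_gt0 n.
by rewrite /z divr_gt0//= ltr_pdivrMr// mul1r /D; lra.
Qed.

Let zE n : 1 - z n = y n / D n.
Proof. by have := D0 n; rewrite /z /D => Dn; field; rewrite gt_eqF. Qed.

(** Adding s <= c balls moves z by (1 - z) s / (D + s) or by - z s / (D + s). *)
Lemma path_jump n : `|z n.+1 - z n| <= c / D n.
Proof.
have [x_gt0 y_gt0] := path_gt0 n.
have Dn := D0 n; have Dn1 := D0 n.+1.
have /andP[z0 z1] := path_proportion_itv n.
have [t /andP[t0 tc] h] := step n.
have aux s : 0 <= s <= t -> 0 <= s / (D n + s) <= c / D n.
  move=> /andP[s0 st].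
  have Ds : 0 < D n + s by rewrite ltr_wpDr.
  apply/andP; split; first by rewrite divr_ge0// ltW.
  apply: ler_pM => //; [by rewrite invr_ge0 ltW|exact: le_trans st tc|].
  by rewrite lef_pV2 ?posrE//; lra.
have bt (q : bool) : 0 <= t * q%:R <= t.
  by case: q; rewrite ?mulr1 ?mulr0 ?lexx ?t0.
case: h => -[hx hy].
- have hs := aux _ (bt (z n < u)).
  set s := t * _ in hx hs.
  have s0 : 0 <= s by rewrite /s; case/andP: (bt (z n < u)).
  have -> : z n.+1 - z n = (1 - z n) * (s / (D n + s)).
    rewrite zE /z /D hx hy; field.
    by move: Dn; rewrite /D => ?; apply/andP; split; rewrite gt_eqF//; lra.
  rewrite ger0_norm; last by rewrite mulr_ge0//; [lra|case/andP: hs].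
  apply: le_trans (_ : s / (D n + s) <= _); last by case/andP: hs.
  by rewrite ler_piMl//; [case/andP: hs|lra].
- have hs := aux _ (bt (l < z n)).
  set s := t * _ in hy hs.
  have s0 : 0 <= s by rewrite /s; case/andP: (bt (l < z n)).
  have -> : z n.+1 - z n = - (z n * (s / (D n + s))).
    rewrite /z /D hx hy; field.
    by move: Dn; rewrite /D => ?; apply/andP; split; rewrite gt_eqF//; lra.
  rewrite normrN ger0_norm; last by rewrite mulr_ge0//; [lra|case/andP: hs].
  apply: le_trans (_ : s / (D n + s) <= _); last by case/andP: hs.
  by rewrite ler_piMl//; [case/andP: hs|lra].
Qed.

Let z_up n : z n <= l -> z n <= z n.+1.
Proof.
move=> zl; have [xn yn] := path_nondecreasing n.
have [[x_gt0 y_gt0] [_ y_gt0']] := (path_gt0 n, path_gt0 n.+1).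
have Dn := D0 n; have Dn1 := D0 n.+1.
have yE : y n.+1 = y n.
  have [t _ [[_ //]|[_ ->]]] := step n.
  by rewrite ltNge zl mulr0 addr0.
rewrite -lerN2 -(lerD2l 1) !zE yE ler_pM2l// lef_pV2 ?posrE//.
by rewrite /D yE lerD2r.
Qed.

Let z_down n : u <= z n -> z n.+1 <= z n.
Proof.
move=> uz; have [xn yn] := path_nondecreasing n.
have [[x_gt0 y_gt0] _] := (path_gt0 n, path_gt0 n.+1).
have Dn := D0 n; have Dn1 := D0 n.+1.
have xE : x n.+1 = x n.
  have [t _ [[-> _]|[-> _]//]] := step n.
  by rewrite ltNge uz mulr0 addr0.
rewrite /z xE ler_pM2l// lef_pV2 ?posrE//.
by rewrite /D xE lerD2l.
Qed.

Hypothesis D_unbounded : forall K : R, exists n, K < D n.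

Let D_large K : exists n0, forall n, (n0 <= n)%N -> K < D n.
Proof.
have [n0 Kn0] := D_unbounded K; exists n0 => n n0n.
have [xn yn] := path_ge n0n; apply: (lt_le_trans Kn0).
by rewrite /D lerD.
Qed.

(** If z stayed at or below l, no red ball would be added any more; then 1 - z = y / D would tend to
    0 although it is at least 1 - l > 0. *)
Let above_lower n0 : exists2 n, (n0 <= n)%N & l < z n.
Proof.
have [l_ge0 [l_lt_u u_le1]] := (l0, (lu, u1)).
apply: contrapT => h.
have zl n : (n0 <= n)%N -> z n <= l.
  by move=> n0n; rewrite leNgt; apply/negP => lz; apply: h; exists n.
have yE n : (n0 <= n)%N -> y n = y n0.
  move/subnK <-; elim: (n - n0)%N => // k IH; rewrite addSn.
  have [t _ [[_ ->//]|[_ ->]]] := step (k + n0).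
  by rewrite ltNge zl ?leq_addl// mulr0 addr0.
have [n1 hn1] := D_large (y n0 / (1 - l)).
pose n := maxn n0 n1.
have := hn1 n (leq_maxr _ _); have := zl n (leq_maxl _ _).
have := zE n; rewrite yE ?leq_maxl// => E zln.
rewrite ltr_pdivrMr; last by lra.
have : D n * (1 - z n) = y n0 by rewrite E mulrCA divff ?mulr1// gt_eqF.
have : D n * (1 - l) <= D n * (1 - z n) by rewrite ler_pM2l//; lra.
lra.
Qed.

Let below_upper n0 : exists2 n, (n0 <= n)%N & z n < u.
Proof.
have [l_ge0 [l_lt_u u_le1]] := (l0, (lu, u1)).
apply: contrapT => h.
have uz n : (n0 <= n)%N -> u <= z n.
  by move=> n0n; rewrite leNgt; apply/negP => zu; apply: h; exists n.
have xE n : (n0 <= n)%N -> x n = x n0.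
  move/subnK <-; elim: (n - n0)%N => // k IH; rewrite addSn.
  have [t _ [[-> _]|[-> _]//]] := step (k + n0).
  by rewrite ltNge uz ?leq_addl// mulr0 addr0.
have [n1 hn1] := D_large (x n0 / u).
pose n := maxn n0 n1.
have := hn1 n (leq_maxr _ _); have := uz n (leq_maxl _ _).
rewrite ltr_pdivrMr; last by lra.
have : D n * z n = x n0 by rewrite /z xE ?leq_maxl// mulrCA divff ?mulr1// gt_eqF.
move=> E uzn; have : D n * u <= D n * z n by rewrite ler_pM2l.
lra.
Qed.

Variable m : nat -> R.
Hypothesis m_step :
  forall n, l < z n < u -> m n.+1 - m n = z n.+1 - z n.
Hypothesis m_cauchy : forall e : R, 0 < e -> exists n0, forall n p,
  (n0 <= n)%N -> (n0 <= p)%N -> `|m n - m p| < e.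
Hypothesis potential_bounded : forall k,
  (forall n, (k <= n)%N -> l < z n < u) ->
  exists K, forall n, (k <= n)%N -> potential c (x n) (y n) < K.

Lemma urn_path_cvg : [/\ z n @[n --> \oo] --> limn_sup z,
  l <= limn_sup z <= u & 0 < limn_sup z < 1].
Proof.
have [l_ge0 [l_lt_u u_le1]] := (l0, (lu, u1)).
have z_cvg : z n @[n --> \oo] --> limn_sup z /\ l <= limn_sup z <= u.
  apply: (@barrier_path_cvg R z m) => //.
    by move=> n; have /andP[? ?] := path_proportion_itv n; apply/andP; split; lra.
  move=> e e0; have [n0 hn0] := D_large (c / e); exists n0 => n /hn0 Dn.
  by apply: le_lt_trans (path_jump n) _; rewrite ltr_pdivrMr// mulrC -ltr_pdivrMr.
move: z_cvg => [zt /andP[lt tu]]; split; [by []|by rewrite lt|].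
set t : R := limn_sup z in zt lt tu *.
have zt_e (e : R) : 0 < e -> exists n0, forall n, (n0 <= n)%N -> `|t - z n| < e.
  by move=> e0; move/cvgrPdist_lt : zt => /(_ e e0)[n0 _ h]; exists n0.
apply/andP; split.
- rewrite lt_neqAle (le_trans l0 lt) andbT; apply/negP => /eqP t0.
  (* A zero limit forces l <= 0, and z > 0 always; once z < u, the path is between the barriers for
     ever and its potential is bounded. *)
  have [|k hk] := zt_e u; first by lra.
  have [n nk|K hK] := @potential_bounded k.
    have := hk n nk; have /andP[? ?] := path_proportion_itv n.
    by rewrite ltr_norml => /andP[? ?]; apply/andP; split; lra.
  (* The potential dominates - ln z, so a bound K on it keeps z above exp(- K). *)
  have [|n0 hn0] := zt_e (expR (- K)); first exact: expR_gt0.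
  pose n := maxn k n0.
  have := hn0 n (leq_maxr _ _); have := hK n (leq_maxl _ _).
  have [xn yn] := path_gt0 n.
  have [/andP[_ h] _] := potential_ge c0 xn yn.
  have zn0 : 0 < z n by case/andP: (path_proportion_itv n).
  have lnz : ln ((x n + y n) / x n) = - ln (z n).
    by rewrite -lnV ?posrE// /z invf_div.
  rewrite -t0 sub0r normrN gtr0_norm// => hKn.
  rewrite -{1}(lnK (x := z n)) ?posrE// ltr_expR.
  by move: h; rewrite lnz; lra.
- rewrite lt_neqAle (le_trans tu u1) andbT; apply/negP => /eqP t1.
  have [|k hk] := zt_e (1 - l); first by lra.
  have [n nk|K hK] := @potential_bounded k.
    have := hk n nk; have /andP[? ?] := path_proportion_itv n.
    by rewrite ltr_norml => /andP[? ?]; apply/andP; split; lra.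
  have [|n0 hn0] := zt_e (expR (- K)); first exact: expR_gt0.
  pose n := maxn k n0.
  have := hn0 n (leq_maxr _ _); have := hK n (leq_maxl _ _).
  have [xn yn] := path_gt0 n.
  have [_ /andP[_ h]] := potential_ge c0 xn yn.
  have zn0 : 0 < 1 - z n by case/andP: (path_proportion_itv n); lra.
  have lnz : ln ((x n + y n) / y n) = - ln (1 - z n).
    by rewrite -lnV ?posrE// zE invf_div.
  rewrite t1 gtr0_norm// => hKn.
  rewrite -{1}(lnK (x := 1 - z n)) ?posrE// ltr_expR.
  by move: h; rewrite lnz; lra.
Qed.

End urn_paths.

(** * Sigma-algebras generated by random variables *)

Section sigma_rv_theory.
Context {d : measure_display} {T : measurableType d} {R : realType}.
Implicit Types (F : set (T -> R)) (C : set (set T)).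

(** The generating family of [sigma_rv F], kept apart because [bmfun] takes a generating family. *)
Definition rv_class F : set (set T) :=
  \bigcup_(Y in F) preimage_set_system setT Y (@measurable _ R).

Lemma rv_class_measurable_fun F (Y : T -> R) : F Y ->
  @measurable_fun _ _ (g_sigma_algebraType (rv_class F)) R setT Y.
Proof.
by move=> FY _ S mS; apply: sub_sigma_algebra; exists Y => //; exists S.
Qed.

Lemma rv_class_sub F C : sigma_algebra setT C ->
  (forall Y, F Y -> forall S, measurable S -> C (Y @^-1` S)) ->
  <<s rv_class F >> `<=` C.
Proof.
move=> sC FC; apply: smallest_sub => // _ [Y FY] [S mS <-].
by rewrite setTI; exact: FC.
Qed.

Lemma rv_classS F F' : F `<=` F' -> <<s rv_class F >> `<=` <<s rv_class F' >>.
Proof.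
move=> FF'; apply: rv_class_sub; first exact: smallest_sigma_algebra.
move=> Y FY S mS; apply: sub_sigma_algebra; exists Y; first exact: FF'.
by exists S => //; rewrite setTI.
Qed.

Lemma rv_class_measurable F :
  (forall Y, F Y -> measurable_fun setT Y) -> <<s rv_class F >> `<=` measurable.
Proof.
move=> mF; apply: rv_class_sub; first exact: sigma_algebra_measurable.
by move=> Y FY S mS; rewrite -[_ @^-1` _]setTI; exact: mF.
Qed.

End sigma_rv_theory.

(** * The random urn *)

Section urn.
Context {d : measure_display} {T : measurableType d} {R : realType}.
Context (P : probability T R) (b r c : R) (L U : {RV P >-> R}).
Context (X B Rd : nat -> {RV P >-> R}) (Z : nat -> T -> R).
Hypotheses (b_gt0 : 0 < b) (r_gt0 : 0 < r)
  (barriers : forall w : T, [/\ 0 <= L w, L w < U w & U w <= 1])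
  (X01 : forall (n : nat) (w : T), (0 < n)%N -> X n w = 0 \/ X n w = 1)
  (B_bnd : forall (n : nat) (w : T), (0 < n)%N -> 0 <= B n w <= c)
  (Z_rec : urn_proportion b r L U X B Rd Z)
  (X_condexp : forall n : nat,
    is_cond_exp P (urn_filtration L U X B Rd n) (X n.+1) (Z n))
  (BR_indep : forall n : nat, (0 < n)%N ->
    indep_sigma P (sigma_rv [set (B n : T -> R); (Rd n : T -> R)])
      (sigma_join (urn_filtration L U X B Rd n.-1)
                  (sigma_rv [set (X n : T -> R)])))
  (RdB : forall (n : nat) (w : T), (0 < n)%N -> Rd n w = B n w).
Local Notation Ex := (Rintegral P setT).
Local Notation bM := (bmfun (@measurable d T)).

Implicit Types (f W : T -> R) (A : set T).

Let history n : set (T -> R) := [set (L : T -> R); (U : T -> R)] `|`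
  \bigcup_(i in [set i | (0 < i <= n)%N])
    [set (X i : T -> R); (B i : T -> R); (Rd i : T -> R)].
Let G n := rv_class (history n).
(** The past and the next amount B_{n+1}, but not the draw X_{n+1}. *)
Let H n := rv_class (history n `|` [set (B n.+1 : T -> R)]).

Definition black n w := b + \sum_(1 <= i < n.+1) black_added U X B Z i w.
Definition red n w := r + \sum_(1 <= i < n.+1) red_added L X Rd Z i w.
Definition total n w := black n w + red n w.

Lemma proportionE n w : Z n w = black n w / total n w.
Proof. by rewrite Z_rec /total /black /red big_split/= addrACA. Qed.

Lemma blackS n w :
  black n.+1 w = black n w + X n.+1 w * B n.+1 w * (Z n w < U w)%R%:R.
Proof. by rewrite /black big_nat_recr//= addrA. Qed.

Lemma redS n w :
  red n.+1 w = red n w + (1 - X n.+1 w) * B n.+1 w * (L w < Z n w)%R%:R.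
Proof. by rewrite /red big_nat_recr//= addrA /red_added RdB. Qed.

Lemma black0 w : black 0%N w = b. Proof. by rewrite /black big_geq// addr0. Qed.
Lemma red0 w : red 0%N w = r. Proof. by rewrite /red big_geq// addr0. Qed.

Lemma urn_step w n : exists2 t : R, 0 <= t <= c &
  (black n.+1 w = black n w + t * (black n w / total n w < U w)%R%:R /\
   red n.+1 w = red n w) \/
  (black n.+1 w = black n w /\
   red n.+1 w = red n w + t * (L w < black n w / total n w)%R%:R).
Proof.
exists (B n.+1 w); first exact: B_bnd.
rewrite -proportionE blackS redS.
have [-> | ->] := X01 w (ltn0Sn n).
  by right; rewrite !mul0r addr0 subr0 mul1r.
by left; rewrite subrr !mul0r addr0 mul1r.
Qed.

Lemma c_ge0 : 0 <= c.
Proof. by have /andP[] := B_bnd point (ltn0Sn 0); exact: le_trans. Qed.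

Let b0 w : 0 < black 0%N w. Proof. by rewrite black0. Qed.
Let r0 w : 0 < red 0%N w. Proof. by rewrite red0. Qed.

Lemma urn_le i n w : (i <= n)%N ->
  [/\ black i w <= black n w, red i w <= red n w & total i w <= total n w].
Proof.
move=> ni; have [bl re] := path_ge (urn_step w) ni.
by split => //; rewrite lerD.
Qed.

Lemma black_ge n w : b <= black n w.
Proof. by have [+ _ _] := urn_le w (leq0n n); rewrite black0. Qed.

Lemma red_ge n w : r <= red n w.
Proof. by have [_ + _] := urn_le w (leq0n n); rewrite red0. Qed.

Lemma total_ge n w : b + r <= total n w.
Proof. by rewrite lerD// ?black_ge// red_ge. Qed.

Lemma br_gt0 : 0 < b + r. Proof. exact: addr_gt0. Qed.

Lemma total_gt0 n w : 0 < total n w.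
Proof. exact: lt_le_trans br_gt0 (total_ge n w). Qed.

Lemma proportion_itv n w : 0 < Z n w < 1.
Proof.
by have := path_proportion_itv (b0 w) (r0 w) (urn_step w) n; rewrite -proportionE.
Qed.

Lemma total_step n w : total n.+1 w = total n w + B n.+1 w *
  (X n.+1 w * (Z n w < U w)%R%:R + (1 - X n.+1 w) * (L w < Z n w)%R%:R).
Proof. by rewrite /total blackS redS; ring. Qed.

(** * Measurability of the urn with respect to its history *)

Lemma filtration_measurable n : <<s G n >> `<=` measurable.
Proof.
apply: rv_class_measurable => Y [[->|->]|[i _ [[->|->]|->]]];
  exact: measurable_funPT.
Qed.

Lemma filtration_step_measurable n : <<s H n >> `<=` measurable.
Proof.
apply: rv_class_measurable => Y [[[->|->]|[i _ [[->|->]|->]]]| ->];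
  exact: measurable_funPT.
Qed.

Lemma filtration_sub n : <<s G n >> `<=` <<s H n >>.
Proof. by apply: rv_classS => Y; left. Qed.

Lemma filtrationS n : <<s G n >> `<=` <<s G n.+1 >>.
Proof.
apply: rv_classS => Y [|[i /= /andP[i0 ni] h]]; first by left.
by right; exists i => //=; rewrite i0 leqW.
Qed.

Lemma bmfun_barriers n : bmfun (G n) L /\ bmfun (G n) U.
Proof.
split; split.
- by apply: rv_class_measurable_fun; left; left.
- by exists 1 => w; have [? ? ?] := barriers w; rewrite ger0_norm; lra.
- by apply: rv_class_measurable_fun; left; right.
- by exists 1 => w; have [? ? ?] := barriers w; rewrite ger0_norm; lra.
Qed.

Lemma bmfun_draw n i : (0 < i <= n)%N -> bmfun (G n) (X i).
Proof.
move=> ni; split.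
  by apply: rv_class_measurable_fun; right; exists i => //; left; left.
exists 1 => w; have /andP[i0 _] := ni.
by have [->|->] := X01 w i0; rewrite ?normr0 ?normr1.
Qed.

Lemma B_norm i w : (0 < i)%N -> `|B i w| <= c.
Proof. by move=> i0; have /andP[? ?] := B_bnd w i0; rewrite ger0_norm. Qed.

Lemma bmfun_added n i : (0 < i <= n)%N -> bmfun (G n) (B i).
Proof.
move=> ni; split.
  by apply: rv_class_measurable_fun; right; exists i => //; left; right.
by have /andP[i0 _] := ni; exists c => w; exact: B_norm.
Qed.

Lemma bmfun_next_added n : bmfun (H n) (B n.+1).
Proof.
split; first by apply: rv_class_measurable_fun; right.
by exists c => w; exact: B_norm.
Qed.

Lemma bmfun_proportion n : bmfun (G n) (Z n).
Proof.
split.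
  by move=> _ S mS; rewrite setTI; have [mZ _ _] := X_condexp n; exact: mZ.
exists 1 => w; have /andP[z0 z1] := proportion_itv n w.
by rewrite gtr0_norm// ltW.
Qed.

Lemma filtration_le i n : (i <= n)%N -> <<s G i >> `<=` <<s G n >>.
Proof.
move/subnK <-; elim: (n - i)%N => // k IH; rewrite addSn.
by apply: subset_trans IH _; exact: filtrationS.
Qed.

Lemma bmfun_black n : bmfun (G n) (black n).
Proof.
apply: bmfunD; first exact: bmfun_cst.
apply: bmfun_sum => i /andP[i0 ni]; apply: bmfunM; last first.
  apply: bmfun_natlt; last by case: (bmfun_barriers n).
  apply: (bmfunS (filtration_le (_ : i.-1 <= n)%N)); last exact: bmfun_proportion.
  by rewrite (leq_trans (leq_pred _)).
by apply: bmfunM; [apply: bmfun_draw|apply: bmfun_added]; rewrite i0.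
Qed.

Lemma bmfun_red n : bmfun (G n) (red n).
Proof.
apply: bmfunD; first exact: bmfun_cst.
apply: bmfun_sum => i /andP[i0 ni]; apply: bmfunM; last first.
  apply: bmfun_natlt; first by case: (bmfun_barriers n).
  apply: (bmfunS (filtration_le (_ : i.-1 <= n)%N)); last exact: bmfun_proportion.
  by rewrite (leq_trans (leq_pred _)).
apply: bmfunM.
  by apply: bmfunB; [exact: bmfun_cst|apply: bmfun_draw; rewrite i0].
have -> : (Rd i : T -> R) = B i by apply/funext => w; rewrite RdB.
by apply: bmfun_added; rewrite i0.
Qed.

Lemma bmfun_total n : bmfun (G n) (total n).
Proof. by apply: bmfunD; [exact: bmfun_black|exact: bmfun_red]. Qed.

Lemma bmfun_filtration n f : bmfun (G n) f -> bM f.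
Proof.
by apply: bmfunS; rewrite g_sigma_measurable; exact: filtration_measurable.
Qed.

Lemma bmfun_filtration_step n f : bmfun (H n) f -> bM f.
Proof.
by apply: bmfunS; rewrite g_sigma_measurable; exact: filtration_step_measurable.
Qed.

Lemma bmfun_widen n f : bmfun (G n) f -> bmfun (H n) f.
Proof. by apply: bmfunS; exact: filtration_sub. Qed.

(** * The innovation, its orthogonality to the past and the next amount, and independence *)

Let xi n w := X n.+1 w - Z n w.

Lemma bmfun_innovation n : bM (xi n).
Proof.
apply: bmfunB; last exact: bmfun_filtration (bmfun_proportion n).
by apply: (@bmfun_filtration n.+1); apply: bmfun_draw; rewrite /= leqnn.
Qed.

Lemma innovation_orthogonal_past n A : <<s G n >> A ->
  Ex (fun w => xi n w * \1_A w) = 0.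
Proof.
move=> GA; have mA := filtration_measurable GA.
have [_ _ /(_ A GA)] := X_condexp n.
move=> /(congr1 fine) => E.
have {}E : \int[P]_(w in A) Z n w = \int[P]_(w in A) X n.+1 w by exact: E.
move: E; rewrite !(RintegralE_indic P A) => E.
have bX : bM (X n.+1).
  by apply: (@bmfun_filtration n.+1); apply: bmfun_draw; rewrite /= leqnn.
have bZ : bM (Z n) := bmfun_filtration (bmfun_proportion n).
under eq_Rintegral do rewrite mulrBl.
have bA := @bM_indic _ _ R _ mA.
by rewrite ExB ?E ?subrr//; exact: bmfunM.
Qed.

(** Independence of two events as orthogonality of a centred indicator, in both orders, so that
    [orthogonal_indic_bmfun] can extend it in either variable. *)
Lemma indep_centred n A C :
  sigma_rv [set (B n.+1 : T -> R); (Rd n.+1 : T -> R)] C ->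
  sigma_join (urn_filtration L U X B Rd n) (sigma_rv [set (X n.+1 : T -> R)]) A ->
  Ex (fun w => (\1_C w - fine (P C)) * \1_A w) = 0 /\
  Ex (fun w => (\1_A w - fine (P A)) * \1_C w) = 0.
Proof.
move=> sC sA; have PCA := @BR_indep n.+1 (ltn0Sn n) _ _ sC sA.
have mC : measurable C.
  by apply: rv_class_measurable sC => Y [->|->]; exact: measurable_funPT.
have mA : measurable A.
  move: sA; apply: smallest_sub; first exact: sigma_algebra_measurable.
  move=> E [|]; first exact: filtration_measurable.
  by apply: rv_class_measurable => Y ->; exact: measurable_funPT.
have key : Ex (fun w => \1_C w * \1_A w) = fine (P C) * fine (P A).
  rewrite -fineM ?fin_num_measure// -PCA -Ex_indic; last exact: measurableI.
  by apply: eq_Rintegral => w _; rewrite /= !indicE in_setI -mulnb natrM.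
have bA := bM_indic mA; have bC := bM_indic mC.
split.
  under eq_Rintegral do rewrite mulrBl.
  rewrite ExB; [|exact: bmfunM|by apply: bmfunM => //; exact: bmfun_cst].
  by rewrite key ExZ// Ex_indic// subrr.
under eq_Rintegral do rewrite mulrBl mulrC.
rewrite ExB; [|exact: bmfunM|by apply: bmfunM => //; exact: bmfun_cst].
by rewrite key ExZ// Ex_indic// mulrC subrr.
Qed.

Let J n := urn_filtration L U X B Rd n `|` sigma_rv [set (X n.+1 : T -> R)].

Lemma join_measurable n : <<s J n >> `<=` measurable.
Proof.
apply: smallest_sub; first exact: sigma_algebra_measurable.
move=> E [|]; first exact: filtration_measurable.
by apply: rv_class_measurable => Y ->; exact: measurable_funPT.
Qed.

Lemma bmfun_join_past n f : bmfun (G n) f -> bmfun (J n) f.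
Proof.
apply: bmfunS; apply: smallest_sub; first exact: smallest_sigma_algebra.
apply: subset_trans (@sub_sigma_algebra _ setT (G n)) _ => A GA.
by apply: sub_sigma_algebra; left.
Qed.

Lemma bmfun_join_draw n : bmfun (J n) (X n.+1).
Proof.
split; last first.
  by have [_] := @bmfun_draw n.+1 n.+1 (leqnn _).
move=> _ S mS; rewrite setTI; apply: sub_sigma_algebra; right.
apply: sub_sigma_algebra; exists (X n.+1 : T -> R) => //.
by exists S => //; rewrite setTI.
Qed.

(** A pi-lambda argument. On A' with C, where A' is past and C depends on B_{n+1}, the variable xi
    1_{A'} depends on the past and the draw, hence is independent of C, and its mean is 0. *)
Lemma innovation_orthogonal_indic n A : <<s H n >> A ->
  Ex (fun w => xi n w * \1_A w) = 0.
Proof.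
pose K := [set E | exists2 A, <<s G n >> A &
  exists2 C, <<s rv_class [set (B n.+1 : T -> R)] >> C & E = A `&` C].
pose D := [set A : set T | measurable A /\ Ex (fun w => xi n w * \1_A w) = 0].
have bxi := bmfun_innovation n.
have HK : <<s H n >> `<=` <<s K >>.
  apply: rv_class_sub; first exact: smallest_sigma_algebra.
  move=> Y [hY|->] S mS; apply: sub_sigma_algebra.
    exists (Y @^-1` S).
      by apply: sub_sigma_algebra; exists Y => //; exists S => //; rewrite setTI.
    exists setT; last by rewrite setIT.
    exact: (@measurableT _ (g_sigma_algebraType (rv_class [set (B n.+1 : T -> R)]))).
  exists setT; first exact: (@measurableT _ (g_sigma_algebraType (G n))).
  exists (B n.+1 @^-1` S); last by rewrite setTI.
  apply: sub_sigma_algebra; exists (B n.+1 : T -> R) => //.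
  by exists S => //; rewrite setTI.
have KI : setI_closed K.
  move=> _ _ [A1 GA1 [C1 BC1 ->]] [A2 GA2 [C2 BC2 ->]].
  exists (A1 `&` A2); first exact: (@measurableI _ (g_sigma_algebraType (G n))).
  exists (C1 `&` C2); last by rewrite setIACA.
  exact: (@measurableI _ (g_sigma_algebraType (rv_class [set (B n.+1 : T -> R)]))).
have mB C : <<s rv_class [set (B n.+1 : T -> R)] >> C -> measurable C.
  by apply: rv_class_measurable => Y ->; exact: measurable_funPT.
have KD : K `<=` D.
  move=> _ [A' GA' [C BC ->]].
  have mA' := filtration_measurable GA'; have mC := mB _ BC.
  split; first exact: measurableI.
  have bA := bM_indic mA'; have bC := bM_indic mC.
  have -> : Ex (fun w => xi n w * \1_(A' `&` C) w) =
      Ex (fun w => (\1_C w - fine (P C)) * (xi n w * \1_A' w)) +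
      fine (P C) * Ex (fun w => xi n w * \1_A' w).
    rewrite -ExZ; last exact: bmfunM.
    rewrite -ExD; last 2 first.
    - apply: bmfunM; last exact: bmfunM.
      by apply: bmfunB => //; exact: bmfun_cst.
    - by apply: bmfunM; [exact: bmfun_cst|exact: bmfunM].
    by apply: eq_Rintegral => w _; rewrite !indicE in_setI -mulnb natrM; ring.
  rewrite innovation_orthogonal_past// mulr0 addr0.
  apply: (@orthogonal_indic_bmfun _ _ _ P (J n)).
  - exact: join_measurable.
  - by apply: bmfunB => //; exact: bmfun_cst.
  - move=> A'' JA''; apply: (indep_centred _ JA'').1.
    by apply: rv_classS BC => Y ->; left.
  - apply: bmfunM; last by apply: bmfun_join_past; exact: bmfun_indic.
    apply: bmfunB; first exact: bmfun_join_draw.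
    exact: bmfun_join_past (bmfun_proportion n).
have DL : lambda_system setT D.
  split => //.
  - split => //; have := innovation_orthogonal_past
      (@measurableT _ (g_sigma_algebraType (G n))); exact.
  - move=> A1 A2 A21 [mA1 E1] [mA2 E2]; split; first exact: measurableD.
    have bA1 := bM_indic mA1; have bA2 := bM_indic mA2.
    have -> : Ex (fun w => xi n w * \1_(A1 `\` A2) w) =
        Ex (fun w => xi n w * \1_A1 w) - Ex (fun w => xi n w * \1_A2 w).
      rewrite -ExB; [|exact: bmfunM|exact: bmfunM].
      apply: eq_Rintegral => w _; rewrite -mulrBr; congr (_ * _).
      rewrite !indicE in_setD; have [w2|_] := boolP (w \in A2).
        by rewrite (mem_set (A21 _ (set_mem w2))) subrr.
      by rewrite andbT subr0.
    by rewrite E1 E2 subrr.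
  - move=> F ndF DF; have mF k : measurable (F k) by case: (DF k).
    have mUF : measurable (\bigcup_k F k) by exact: bigcup_measurable.
    split => //; set A' := \bigcup_k F k.
    have bA' := bM_indic mUF.
    have [_ [K0 xiK]] := bxi.
    have K0_ge0 : 0 <= K0 by rewrite (le_trans _ (xiK point)).
    (* Since xi is bounded by [K0], replacing A' by [F k] costs at most [K0] times the missing
       probability, which tends to 0. *)
    have bd k : `|Ex (fun w => xi n w * \1_A' w)| <=
        K0 * (fine (P A') - fine (P (F k))).
      have bF := bM_indic (mF k).
      have FA w : \1_(F k) w <= \1_A' w :> R.
        rewrite !indicE; have [wF|_] := boolP (w \in F k); last exact: ler0n.
        by rewrite (mem_set (_ : A' w))//; exists k => //; exact: set_mem.
      have -> : Ex (fun w => xi n w * \1_A' w) =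
          Ex (fun w => xi n w * (\1_A' w - \1_(F k) w)).
        rewrite -[LHS]subr0 -[X in _ - X](DF k).2 -ExB; last 2 first.
        - exact: bmfunM.
        - exact: bmfunM.
        by apply: eq_Rintegral => w _; rewrite mulrBr.
      have bxiA : bM (fun w => xi n w * (\1_A' w - \1_(F k) w)).
        by apply: bmfunM => //; exact: bmfunB.
      have bK : bM (fun w => K0 * (\1_A' w - \1_(F k) w)).
        by apply: bmfunM; [exact: bmfun_cst|exact: bmfunB].
      have -> : K0 * (fine (P A') - fine (P (F k))) =
          Ex (fun w => K0 * (\1_A' w - \1_(F k) w)).
        rewrite ExZ; last exact: bmfunB.
        by rewrite ExB// !Ex_indic.
      have hn w : `|xi n w * (\1_A' w - \1_(F k) w)| <=
          K0 * (\1_A' w - \1_(F k) w).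
        by rewrite normrM ler_pM// ger0_norm// subr_ge0.
      rewrite ler_norml; apply/andP; split.
      + rewrite -[X in - X]mul1r -mulNr -ExZ//; apply: le_Ex => //.
          by apply: bmfunM => //; exact: bmfun_cst.
        by move=> w; have := hn w; rewrite ler_norml mulN1r => /andP[].
      + apply: le_Ex => // w.
        by have := hn w; rewrite ler_norml => /andP[].
    have cv : fine (P (F k)) @[k --> \oo] --> fine (P A').
      apply: fine_cvg; rewrite fineK ?fin_num_measure//.
      exact: nondecreasing_cvg_mu.
    apply/eqP; rewrite -normr_le0.
    have cv' : K0 * (fine (P A') - fine (P (F k))) @[k --> \oo] --> (0 : R).
      rewrite -[X in _ --> X](mulr0 K0) -[X in _ * X](subrr (fine (P A'))).
      by apply: cvgMr; apply: cvgB => //; exact: cvg_cst.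
    rewrite -(cvg_lim _ cv')//; apply: limr_ge; last exact: nearW.
    by apply/cvg_ex; eexists; exact: cv'.
move=> /HK; have : <<s K >> `<=` D by exact: (lambda_system_subset KI DL KD).
by move=> KD' /KD'[].
Qed.

Lemma innovation_orthogonal n W : bmfun (H n) W ->
  Ex (fun w => xi n w * W w) = 0.
Proof.
apply: orthogonal_indic_bmfun; first exact: filtration_step_measurable.
  exact: bmfun_innovation.
exact: innovation_orthogonal_indic.
Qed.

Lemma added_independent n W : bmfun (J n) W ->
  Ex (fun w => B n.+1 w * W w) = Ex (B n.+1) * Ex W.
Proof.
move=> bW.
have bB : bM (B n.+1) := bmfun_filtration_step (bmfun_next_added n).
have bW' : bM W.
  by apply: bmfunS bW; rewrite g_sigma_measurable; exact: join_measurable.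
have h : Ex (fun w => (B n.+1 w - Ex (B n.+1)) * W w) = 0.
  apply: (@orthogonal_indic_bmfun _ _ _ P (J n)) => //.
  - exact: join_measurable.
  - by apply: bmfunB => //; exact: bmfun_cst.
  move=> A JA; have mA := join_measurable JA; have bA := bM_indic mA.
  (* Orthogonality is first extended from events of B_{n+1} to B_{n+1} itself with [A] fixed; the
     outer application then extends it from [A] to [W]. *)
  have h : Ex (fun w => (\1_A w - fine (P A)) * B n.+1 w) = 0.
    apply: (@orthogonal_indic_bmfun _ _ _ P
      (rv_class [set (B n.+1 : T -> R); (Rd n.+1 : T -> R)])).
    - by apply: rv_class_measurable => Y [->|->]; exact: measurable_funPT.
    - by apply: bmfunB => //; exact: bmfun_cst.
    - by move=> C BC; exact: (indep_centred BC JA).2.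
    - split; first by apply: rv_class_measurable_fun; left.
      by exists c => w; exact: B_norm.
  move: h; under eq_Rintegral do rewrite mulrBl.
  rewrite ExB; [|exact: bmfunM|by apply: bmfunM => //; exact: bmfun_cst].
  rewrite ExZ// => h.
  under eq_Rintegral do rewrite mulrBl mulrC.
  rewrite ExB; [|exact: bmfunM|by apply: bmfunM => //; exact: bmfun_cst].
  by rewrite ExZ// Ex_indic// [X in _ - X]mulrC.
move: h; under eq_Rintegral do rewrite mulrBl.
rewrite ExB; [|exact: bmfunM|by apply: bmfunM => //; exact: bmfun_cst].
by rewrite ExZ// => /eqP; rewrite subr_eq0 => /eqP.
Qed.

(** Otherwise each late step adds in mean at least q (m / K) e on the event that the total is at
    most K, with m = min(b, r); but on every path such steps add at most K + c altogether. *)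
Lemma total_bounded_unlikely q n0 K e : 0 < q ->
  (forall n, (n0 <= n)%N -> q <= Ex (B n)) -> 0 < K -> 0 < e ->
  exists n, fine (P [set w | total n w <= K]) <= e.
Proof.
move=> q0 hq K0 e0; apply: contrapT => hp.
have [b_pos [r_pos c_pos]] := (b_gt0, (r_gt0, c_ge0)).
pose A i := [set w | total i w <= K].
have GA i : <<s G i >> (A i).
  by apply: bmfun_le; [exact: bmfun_total|exact: bmfun_cst].
have bA i : bM (\1_(A i) : T -> R).
  by apply: bM_indic; exact: filtration_measurable (GA i).
pose m := Num.min b r.
have m0 : 0 < m by rewrite lt_min b_pos.
pose S i w := \1_(A i) w * (total i.+1 w - total i w).
have bS i : bM (S i).
  apply: bmfunM => //; apply: bmfunB; last exact: bmfun_filtration (bmfun_total i).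
  exact: bmfun_filtration (bmfun_total i.+1).
have sumS n w : \sum_(n0 <= i < n) S i w <= total n w /\
    \sum_(n0 <= i < n) S i w <= K + c.
  have tot_pos k : 0 <= total k w by exact: ltW (total_gt0 k w).
  elim: n => [|n [IH1 IH2]]; first by rewrite big_geq//; split=> //; lra.
  have [n0n|nn0] := leqP n0 n; last by rewrite big_geq//; split=> //; lra.
  rewrite big_nat_recr//= /S indicE.
  have [_ _ tn] := urn_le w (leqnSn n).
  have [wA|_] := boolP (w \in A n); last by rewrite mul0r addr0; split => //; lra.
  move: wA; rewrite inE /A/= => DK; rewrite mul1r.
  have : total n.+1 w <= total n w + c.
    rewrite total_step lerD2l.
    have /andP[B0 Bc] := B_bnd w (ltn0Sn n).
    by have [->|->] := X01 w (ltn0Sn n); case: (_ < _); case: (_ < _);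
      rewrite ?subrr ?subr0 ?mulr0 ?mulr1 ?add0r ?addr0 ?mulr0 ?mulr1.
  by split; lra.
have ES i : (n0 <= i)%N -> q * (m / K) * e <= Ex (S i).
  move=> n0i.
  pose V w := \1_(A i) w *
    (X i.+1 w * (Z i w < U w)%R%:R + (1 - X i.+1 w) * (L w < Z i w)%R%:R).
  have [bL bU] := bmfun_barriers i; have bZ := bmfun_proportion i.
  have bUi : bmfun (G i) (fun w => (Z i w < U w)%R%:R : R) by exact: bmfun_natlt.
  have bLi : bmfun (G i) (fun w => (L w < Z i w)%R%:R : R) by exact: bmfun_natlt.
  have bGA : bmfun (G i) (\1_(A i) : T -> R) by exact: bmfun_indic.
  have bV : bmfun (J i) V.
    apply: bmfunM; first exact: bmfun_join_past.
    apply: bmfunD; apply: bmfunM.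
    - exact: bmfun_join_draw.
    - exact: bmfun_join_past.
    - by apply: bmfunB; [exact: bmfun_cst|exact: bmfun_join_draw].
    - exact: bmfun_join_past.
  have -> : Ex (S i) = Ex (B i.+1) * Ex V.
    rewrite -added_independent//; apply: eq_Rintegral => w _.
    by rewrite /S /V total_step; ring.
  pose W0 w := \1_(A i) w * ((Z i w < U w)%R%:R - (L w < Z i w)%R%:R) : R.
  pose W1 w := \1_(A i) w *
    (Z i w * (Z i w < U w)%R%:R + (1 - Z i w) * (L w < Z i w)%R%:R) : R.
  have bW0 : bmfun (G i) W0 by apply: bmfunM => //; exact: bmfunB.
  have bW1 : bmfun (G i) W1.
    apply: bmfunM => //; apply: bmfunD; apply: bmfunM => //.
    by apply: bmfunB => //; exact: bmfun_cst.
  (* Writing X = Z + xi replaces the draw by its conditional mean, up to the term xi * W0 of mean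
     0. *)
  have EV : Ex V = Ex W1.
    have -> : Ex V = Ex (fun w => xi i w * W0 w) + Ex W1.
      rewrite -ExD; last 2 first.
      - apply: bmfunM; first exact: bmfun_innovation.
        exact: bmfun_filtration bW0.
      - exact: bmfun_filtration bW1.
      by apply: eq_Rintegral => w _; rewrite /V /W0 /W1 /xi; ring.
    by rewrite innovation_orthogonal ?add0r//; exact: bmfun_widen.
  have mK : 0 < m / K by rewrite divr_gt0.
  have EW1 : m / K * e <= Ex W1.
    apply: (@le_trans _ _ (Ex (fun w => m / K * \1_(A i) w))).
      rewrite ExZ// ler_pM2l// Ex_indic//; last exact: filtration_measurable (GA i).
      by rewrite leNgt; apply/negP => pe; apply: hp; exists i; exact: ltW.
    apply: le_Ex => [||w]; [|exact: bmfun_filtration bW1|].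
      by apply: bmfunM => //; exact: bmfun_cst.
    rewrite /W1 mulrC indicE.
    have [wA|_] := boolP (w \in A i); last by rewrite !mul0r.
    move: wA; rewrite inE /A/= !mul1r => DK.
    have D0 := total_gt0 i w.
    have iKD : K^-1 <= (total i w)^-1 by rewrite lef_pV2.
    have iK0 : 0 <= K^-1 by rewrite invr_ge0 ltW.
    have mb : m <= b by rewrite ge_min lexx.
    have mr : m <= r by rewrite ge_min lexx orbT.
    have Zm : m / K <= Z i w.
      rewrite proportionE ler_pM// ?(ltW m0)//.
      exact: le_trans mb (black_ge i w).
    have Zm' : m / K <= 1 - Z i w.
      have -> : 1 - Z i w = red i w / total i w.
        rewrite proportionE; move: D0; rewrite /total => D0.
        by field; rewrite gt_eqF.
      rewrite ler_pM// ?(ltW m0)//.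
      exact: le_trans mr (red_ge i w).
    have [_ LU _] := barriers w.
    (* As L < U, the two indicators cannot both vanish, and each is weighted by at least m / K. *)
    have [zu|uz] := ltP (Z i w) (U w); have [lz|zl] := ltP (L w) (Z i w);
      rewrite ?mulr0 ?mulr1 ?addr0 ?add0r//; lra.
  rewrite EV -mulrA; apply: ler_pM => //; [exact: ltW|by rewrite mulr_ge0// ltW|].
  by apply: hq; rewrite leqW.
pose a := q * (m / K) * e.
have a0 : 0 < a by rewrite !mulr_gt0// invr_gt0.
pose k := (Num.truncn ((K + c) / a)).+1.
have ka : (K + c) / a < k%:R by exact: truncnS_gt.
have : a * k%:R <= K + c.
  apply: (@le_trans _ _ (Ex (fun w => \sum_(n0 <= i < n0 + k) S i w))).
    rewrite Ex_sum//.
    have -> : a * k%:R = \sum_(n0 <= i < n0 + k) a.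
      by rewrite sumr_const_nat addKn mulr_natr.
    by apply: ler_sum_nat => i /andP[n0i _]; exact: ES.
  rewrite -[leRHS](Ex_cst P); apply: le_Ex => [||w].
  - by apply: bmfun_sum => i _.
  - exact: bmfun_cst.
  - by have [_] := sumS (n0 + k)%N w.
by rewrite leNgt mulrC -ltr_pdivrMr// ka.
Qed.

(** [f1] and [f0] are the values after a black and a red draw. They may depend on B_{n+1}, so the
    inequality for their mean is needed only pointwise, with the amount fixed. *)
Lemma drift_le0 n A (Y Y' f1 f0 : T -> R) : <<s G n >> A ->
  bM Y' -> bmfun (G n) Y -> bmfun (H n) f1 -> bmfun (H n) f0 ->
  (forall w, A w -> Y' w = X n.+1 w * f1 w + (1 - X n.+1 w) * f0 w) ->
  (forall w, A w -> Z n w * f1 w + (1 - Z n w) * f0 w <= Y w) ->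
  Ex (fun w => \1_A w * (Y' w - Y w)) <= 0.
Proof.
move=> GA bY' bY b1 b0' YE drift.
have bA : bmfun (H n) (\1_A : T -> R) by apply: bmfun_widen; exact: bmfun_indic.
have bZ := bmfun_widen (bmfun_proportion n).
have bY1 := bmfun_widen bY.
pose W0 w := \1_A w * (f1 w - f0 w).
pose W1 w := \1_A w * (Z n w * f1 w + (1 - Z n w) * f0 w - Y w).
have bW0 : bmfun (H n) W0 by apply: bmfunM => //; exact: bmfunB.
have bW1 : bmfun (H n) W1.
  apply: bmfunM => //; apply: bmfunB => //; apply: bmfunD; apply: bmfunM => //.
  by apply: bmfunB => //; exact: bmfun_cst.
have -> : Ex (fun w => \1_A w * (Y' w - Y w)) =
    Ex (fun w => xi n w * W0 w) + Ex W1.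
  rewrite -ExD; last 2 first.
  - apply: bmfunM; first exact: bmfun_innovation.
    exact: bmfun_filtration_step bW0.
  - exact: bmfun_filtration_step bW1.
  apply: eq_Rintegral => w _; rewrite /W0 /W1 /xi indicE.
  have [wA|_] := boolP (w \in A); last by rewrite !mul0r mulr0 addr0.
  by rewrite YE; [ring|exact: set_mem].
rewrite innovation_orthogonal// add0r -(Ex_cst P 0).
apply: le_Ex => [||w].
- exact: bmfun_filtration_step bW1.
- exact: bmfun_cst.
- rewrite /W1 indicE; have [wA|_] := boolP (w \in A); last by rewrite mul0r.
  by rewrite mul1r subr_le0; apply: drift; exact: set_mem.
Qed.

(** * Supermartingales for the urn between the barriers *)

Definition interior n : set T := [set w | L w < Z n w < U w].

Lemma filtration_interior n : <<s G n >> (interior n).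
Proof.
have [bL bU] := bmfun_barriers n; have bZ := bmfun_proportion n.
have -> : interior n = [set w | L w < Z n w] `&` [set w | Z n w < U w].
  by apply/seteqP; split => w; [move=> /andP[]|move=> [lz zu]; apply/andP].
apply: (@measurableI _ (g_sigma_algebraType (G n)));
  by apply: (@bmfun_lt _ _ _ (G n)).
Qed.

(** Started at time k and stopped on leaving the interior, the potential reaches K with probability
    at most E(Y_k) / K, which is arbitrarily small. *)
Lemma interior_potential_bounded k : {ae P, forall w,
  (forall n, (k <= n)%N -> interior n w) ->
  exists K, forall n, (k <= n)%N -> potential c (black n w) (red n w) < K}.
Proof.
pose Y n w := potential c (black n w) (red n w).
have black_gt0 n w : 0 < black n w := lt_le_trans b_gt0 (black_ge n w).
have red_gt0 n w : 0 < red n w := lt_le_trans r_gt0 (red_ge n w).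
have bpot C (f g : T -> R) : bmfun C f -> bmfun C g ->
    (forall w, b <= f w) -> (forall w, r <= g w) ->
    bmfun C (fun w => potential c (f w) (g w)).
  move=> bf bg f0 g0.
  have bfV := bmfunV b_gt0 f0 bf; have bgV := bmfunV r_gt0 g0 bg.
  have f_gt0 w : 0 < f w := lt_le_trans b_gt0 (f0 w).
  have g_gt0 w : 0 < g w := lt_le_trans r_gt0 (g0 w).
  apply: bmfunD; [apply: bmfunD; [apply: bmfunD|]|].
  - apply: bmfun_ln => [w|]; last by apply: bmfunM => //; exact: bmfunD.
    by rewrite ler_pdivlMr// mul1r lerDl ltW.
  - apply: bmfun_ln => [w|]; last by apply: bmfunM => //; exact: bmfunD.
    by rewrite ler_pdivlMr// mul1r lerDr ltW.
  - by apply: bmfunM => //; exact: bmfun_cst.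
  - by apply: bmfunM => //; exact: bmfun_cst.
have bY n : bmfun (G n) (Y n).
  apply: bpot; [exact: bmfun_black|exact: bmfun_red| |].
    by move=> w; exact: black_ge.
  by move=> w; exact: red_ge.
have Y0 n w : 0 <= Y n w.
  have [/andP[h1 h2] _] := potential_ge c_ge0 (black_gt0 n w) (red_gt0 n w).
  exact: le_trans h2.
have drift n A : <<s G n >> A -> A `<=` interior n ->
    Ex (fun w => \1_A w * (Y n.+1 w - Y n w)) <= 0.
  move=> GA AI; have bN := bmfun_next_added n.
  have B0 w : 0 <= B n.+1 w <= c by exact: B_bnd.
  apply: (@drift_le0 n A (Y n) (Y n.+1)
    (fun w => potential c (black n w + B n.+1 w) (red n w))
    (fun w => potential c (black n w) (red n w + B n.+1 w))) => //.
  - exact: bmfun_filtration (bY n.+1).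
  - apply: bpot; [|exact: bmfun_widen (bmfun_red n)| |exact: red_ge].
      by apply: bmfunD => //; exact: bmfun_widen (bmfun_black n).
    by move=> w; rewrite ler_wpDr ?black_ge//; case/andP: (B0 w).
  - apply: bpot; [exact: bmfun_widen (bmfun_black n)| |exact: black_ge|].
      by apply: bmfunD => //; exact: bmfun_widen (bmfun_red n).
    by move=> w; rewrite ler_wpDr ?red_ge//; case/andP: (B0 w).
  - move=> w /AI /andP[lz zu]; rewrite /Y blackS redS lz zu !mulr1.
    have [->|->] := X01 w (ltn0Sn n).
      by rewrite subr0 !mul0r !mul1r addr0 add0r.
    by rewrite subrr !mul0r !mul1r !addr0.
  - move=> w _; have -> : 1 - Z n w = red n w / total n w.
      rewrite proportionE; have := total_gt0 n w; rewrite /total => D0.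
      by field; rewrite gt_eqF.
    by rewrite proportionE; exact: potential_drift.
have EY0 : 0 <= Ex (Y k) by rewrite -(Ex_cst P 0); apply: le_Ex => //;
  [exact: bmfun_cst|exact: bmfun_filtration (bY k)].
apply: negligible_eps => e e0.
(* Then E(Y_k) / K <= e; the added 1 keeps K positive. *)
pose K := Ex (Y k) / e + 1.
have K0 : 0 < K by rewrite ltr_wpDl// divr_ge0// ltW.
have GS n : <<s G (k + n)%N >> `<=` <<s G (k + n.+1)%N >>.
  by rewrite addnS; exact: filtrationS.
have drift' n A : <<s G (k + n)%N >> A -> A `<=` interior (k + n) ->
    Ex (fun w => \1_A w * (Y (k + n.+1)%N w - Y (k + n)%N w)) <= 0.
  by rewrite addnS; exact: drift.
have [E mE [subE PE]] := @stopped_maximal_inequality _ _ _ P (fun n => G (k + n)%N)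
  (fun n => interior (k + n)) (fun n => Y (k + n)%N) K K0
  (fun n => @filtration_measurable (k + n)%N)
  GS
  (fun n => bY (k + n)%N) (fun n => Y0 (k + n)%N)
  (fun n => @filtration_interior (k + n)%N)
  drift'.
exists E => //; split.
  move=> w /= h; apply: contrapT => hE; apply: h => intk.
  exists K => n kn; rewrite ltNge; apply/negP => Kn; apply: hE.
  apply: (subE w (n - k)%N); first by rewrite subnKC.
  by move=> i _; apply: intk; exact: leq_addr.
apply: le_trans PE _; rewrite addn0 lee_fin ler_pdivrMr// /K mulrDr mulr1.
by rewrite mulrCA divff ?gt_eqF// mulr1 lerDl ltW.
Qed.

Definition interior_sum n w : R :=
  \sum_(0 <= i < n) \1_(interior i) w * (Z i.+1 w - Z i w).

Lemma bmfun_interior_sum n : bmfun (G n) (interior_sum n).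
Proof.
apply: bmfun_sum => i /andP[_ ni]; apply: bmfunM.
  apply: (bmfunS (filtration_le (ltnW ni))); apply: bmfun_indic.
  exact: filtration_interior.
apply: bmfunB; first exact: (bmfunS (filtration_le ni) (bmfun_proportion i.+1)).
exact: (bmfunS (filtration_le (ltnW ni)) (bmfun_proportion i)).
Qed.

Lemma interior_sumS n w : interior n w ->
  interior_sum n.+1 w - interior_sum n w = Z n.+1 w - Z n w.
Proof.
move=> iw; rewrite /interior_sum big_nat_recr//= addrAC subrr add0r indicE.
by rewrite mem_set// mul1r.
Qed.

Lemma bmfun_totalV C n (f : T -> R) : <<s G n >> `<=` <<s C >> ->
  bmfun C f -> (forall w, 0 <= f w) -> bmfun C (fun w => (total n w + f w)^-1).
Proof.
move=> GC bf f0; apply: (bmfunV br_gt0).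
  by move=> w; rewrite ler_wpDr// total_ge.
by apply: bmfunD => //; exact: bmfunS GC (bmfun_total n).
Qed.

(** The supermartingale [Y k] starts at c / total_k, so the sum leaves the e-neighbourhood of its
    value at k with probability at most E(c / total_k) / e^2; this is small for a suitable k because
    the total is rarely bounded. *)
Lemma interior_sum_cauchy q n0 e : 0 < q ->
  (forall n, (n0 <= n)%N -> q <= Ex (B n)) -> 0 < e ->
  {ae P, forall w, exists k, forall n, (k <= n)%N ->
    `|interior_sum n w - interior_sum k w| < e}.
Proof.
move=> q0 hq e0.
pose Y k n w := (interior_sum n w - interior_sum k w) ^+ 2 + c / total n w.
have ctot n w : 0 <= c / total n w.
  by rewrite divr_ge0 ?c_ge0// ltW// total_gt0.
have Y0 k n w : 0 <= Y k n w by rewrite addr_ge0// sqr_ge0.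
have bctot n : bmfun (G n) (fun w => c / total n w).
  apply: bmfunM; first exact: bmfun_cst.
  by apply: (bmfunV br_gt0); [exact: total_ge|exact: bmfun_total].
have bdiff k n : (k <= n)%N ->
    bmfun (G n) (fun w => interior_sum n w - interior_sum k w).
  move=> kn; apply: bmfunB; first exact: bmfun_interior_sum.
  exact: bmfunS (filtration_le kn) (bmfun_interior_sum k).
have bY k n : (k <= n)%N -> bmfun (G n) (Y k n).
  move=> kn; apply: bmfunD => //; rewrite /exprz.
  by apply: bmfunM; exact: bdiff.
have drift k n A : (k <= n)%N -> <<s G n >> A ->
    Ex (fun w => \1_A w * (Y k n.+1 w - Y k n w)) <= 0.
  move=> kn GA; have bN := bmfun_next_added n.
  have B0 w : 0 <= B n.+1 w <= c by exact: B_bnd.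
  have [bL bU] := bmfun_barriers n; have bZ := bmfun_proportion n.
  pose m w := interior_sum n w - interior_sum k w.
  pose s w := B n.+1 w / (total n w + B n.+1 w).
  pose f1 w := (m w + \1_(interior n) w * ((1 - Z n w) * s w)) ^+ 2 +
    c / (total n w + B n.+1 w * (Z n w < U w)%R%:R).
  pose f0 w := (m w - \1_(interior n) w * (Z n w * s w)) ^+ 2 +
    c / (total n w + B n.+1 w * (L w < Z n w)%R%:R).
  have bm : bmfun (H n) m by exact: bmfun_widen (bdiff k n kn).
  have bI : bmfun (H n) (\1_(interior n) : T -> R).
    by apply: bmfun_widen; apply: bmfun_indic; exact: filtration_interior.
  have bs : bmfun (H n) s.
    apply: bmfunM => //; apply: bmfun_totalV => //; first exact: filtration_sub.
    by move=> w; case/andP: (B0 w).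
  have bZH := bmfun_widen bZ.
  have bcV (f : T -> bool) : bmfun (G n) (fun w => (f w)%:R : R) ->
      bmfun (H n) (fun w => c / (total n w + B n.+1 w * (f w)%:R)).
    move=> bf; apply: bmfunM; first exact: bmfun_cst.
    apply: bmfun_totalV; first exact: filtration_sub.
      by apply: bmfunM => //; exact: bmfun_widen.
    by move=> w; rewrite mulr_ge0//; case/andP: (B0 w).
  apply: (@drift_le0 n A (Y k n) (Y k n.+1) f1 f0) => //.
  - exact: bmfun_filtration (bY k n.+1 (leqW kn)).
  - exact: bY.
  - apply: bmfunD; last by apply: (bcV (fun w => Z n w < U w)); exact: bmfun_natlt.
    have b1 : bmfun (H n) (fun w => m w + \1_(interior n) w * ((1 - Z n w) * s w)).
      apply: bmfunD => //; apply: bmfunM => //; apply: bmfunM => //.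
      by apply: bmfunB => //; exact: bmfun_cst.
    exact: bmfunM.
  - apply: bmfunD; last by apply: (bcV (fun w => L w < Z n w)); exact: bmfun_natlt.
    have b1 : bmfun (H n) (fun w => m w - \1_(interior n) w * (Z n w * s w)).
      by apply: bmfunB => //; apply: bmfunM => //; exact: bmfunM.
    exact: bmfunM.
  - move=> w _; have D0 := total_gt0 n w; have /andP[Bw0 Bwc] := B0 w.
    have DB0 : 0 < total n w + B n.+1 w by lra.
    have mS : interior_sum n.+1 w - interior_sum k w =
        m w + \1_(interior n) w * (Z n.+1 w - Z n w).
      by rewrite /interior_sum big_nat_recr//= addrAC.
    rewrite /Y mS /f1 /f0 total_step indicE.
    have ZE : w \in interior n -> Z n.+1 w - Z n w =
        (X n.+1 w - Z n w) * s w.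
      rewrite inE => /andP[lz zu].
      rewrite (proportionE n.+1) total_step blackS lz zu /s.
      rewrite (proportionE n); move: D0 DB0; set DD := total n w => D0 DB0.
      have [->|->] := X01 w (ltn0Sn n).
        by rewrite !(mulr0,mulr1,mul0r,subr0,add0r,addr0); field; rewrite !gt_eqF.
      by rewrite !(mulr0,mulr1,mul1r,subrr,mul0r,add0r,addr0); field; rewrite !gt_eqF.
    have [wI|_] := boolP (w \in interior n).
      rewrite ZE//; have [->|->] := X01 w (ltn0Sn n).
        by rewrite !(mul0r,mul1r,subr0,add0r,addr0) mulNr.
      by rewrite !(mul0r,mul1r,subrr,add0r,addr0).
    have [->|->] := X01 w (ltn0Sn n).
      by rewrite !(mul0r,mul1r,subr0,add0r,addr0).
    by rewrite !(mul0r,mul1r,subrr,subr0,add0r,addr0).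
  - move=> w _; have D0 := total_gt0 n w; have /andP[Bw0 Bwc] := B0 w.
    have /andP[z0 z1] := proportion_itv n w.
    have z01 : 0 <= Z n w <= 1 by rewrite !ltW.
    rewrite /f1 /f0 /Y indicE.
    have [wI|_] := boolP (w \in interior n).
      move: wI; rewrite inE => /andP[-> ->]; rewrite !mulr1 !mul1r.
      exact: square_drift.
    (* Outside the interior the sum does not move, and c / total can only decrease. *)
    rewrite !mul0r subr0 addr0 -/(m w).
    have cD (v : bool) : c / (total n w + B n.+1 w * v%:R) <= c / total n w.
      have Bv : 0 <= B n.+1 w * v%:R by rewrite mulr_ge0.
      have Dv : 0 < total n w + B n.+1 w * v%:R by rewrite ltr_wpDr.
      by apply: ler_wpM2l; rewrite ?c_ge0// lef_pV2 ?posrE// lerDl.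
    have h1 : Z n w * (m w ^+ 2 + c / (total n w + B n.+1 w * (Z n w < U w)%R%:R))
        <= Z n w * (m w ^+ 2 + c / total n w).
      by rewrite ler_pM2l// lerD2l.
    have h0 : (1 - Z n w) * (m w ^+ 2 +
          c / (total n w + B n.+1 w * (L w < Z n w)%R%:R))
        <= (1 - Z n w) * (m w ^+ 2 + c / total n w).
      by rewrite ler_pM2l ?subr_gt0// lerD2l.
    apply: le_trans (lerD h1 h0) _.
    by rewrite -mulrDl addrC subrK mul1r.
have small dlt : 0 < dlt -> exists k, Ex (fun w => c / total k w) <= dlt.
  move=> dlt0; have [c_pos br0] := (c_ge0, br_gt0).
  pose K := c / (dlt / 2) + 1.
  have d20 : 0 < dlt / 2 by lra.
  have K0 : 0 < K by rewrite ltr_wpDl// divr_ge0// ltW.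
  have cK : c / K <= dlt / 2.
    by rewrite ler_pdivrMr// /K mulrDr mulr1 mulrCA divff ?gt_eqF// mulr1; lra.
  (* On the rare event c / total is at most c / (b + r), so probability [e2] costs at most dlt / 2
     there; the denominator c + 1 allows c = 0. *)
  pose e2 := dlt / 2 * (b + r) / (c + 1).
  have c10 : 0 < c + 1 by lra.
  have e20 : 0 < e2 by rewrite !mulr_gt0// invr_gt0.
  have [k hk] := total_bounded_unlikely q0 hq K0 e20; exists k.
  pose A := [set w | total k w <= K].
  have mA : measurable A.
    apply: (@filtration_measurable k).
    by apply: bmfun_le; [exact: bmfun_total|exact: bmfun_cst].
  have bA := @bM_indic _ _ R _ mA.
  have bA1 : bM (fun w => c / (b + r) * \1_A w).
    by apply: bmfunM => //; exact: bmfun_cst.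
  have bA2 : bM (fun w : T => c / K) by exact: bmfun_cst.
  apply: (@le_trans _ _ (Ex (fun w => c / (b + r) * \1_A w + c / K))).
    apply: le_Ex => [||w]; [exact: bmfun_filtration (bctot k)|exact: bmfunD|].
    have D0 := total_gt0 k w; rewrite indicE.
    have cK0 : 0 <= c / K by rewrite divr_ge0// ltW.
    have [wA|wA] := boolP (w \in A).
      rewrite mulr1 ler_wpDr// ler_wpM2l// lef_pV2 ?posrE//.
      exact: total_ge.
    rewrite mulr0 add0r ler_wpM2l// lef_pV2 ?posrE//.
    by move: wA; rewrite notin_setE /A/= => /negP; rewrite -ltNge => /ltW.
  rewrite ExD// ExZ// Ex_indic// Ex_cst.
  have : c / (b + r) * fine (P A) <= c / (b + r) * e2.
    by rewrite ler_wpM2l// divr_ge0// ltW.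
  have : c / (b + r) * e2 = dlt / 2 * (c / (c + 1)).
    by rewrite /e2; field; rewrite !gt_eqF.
  have : dlt / 2 * (c / (c + 1)) <= dlt / 2.
    by rewrite ler_piMr ?(ltW d20)// ler_pdivrMr//; lra.
  by lra.
apply: negligible_eps => e' e'0.
have e20 : 0 < e ^+ 2 by rewrite exprn_gt0.
have [|k hk] := small (e' * e ^+ 2); first exact: mulr_gt0.
have GS n : <<s G (k + n)%N >> `<=` <<s G (k + n.+1)%N >>.
  by rewrite addnS; exact: filtrationS.
have drift' n A : <<s G (k + n)%N >> A -> A `<=` setT ->
    Ex (fun w => \1_A w * (Y k (k + n.+1)%N w - Y k (k + n)%N w)) <= 0.
  by move=> GA _; rewrite addnS; apply: drift => //; exact: leq_addr.
have [E mE [subE PE]] := @stopped_maximal_inequality _ _ _ P (fun n => G (k + n)%N)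
  (fun=> setT) (fun n => Y k (k + n)%N) (e ^+ 2) e20
  (fun n => @filtration_measurable (k + n)%N)
  GS
  (fun n => bY k (k + n)%N (leq_addr n k)) (fun n => Y0 k (k + n)%N)
  (fun n => @measurableT _ (g_sigma_algebraType (G (k + n)%N)))
  drift'.
exists E => //; split.
  move=> w /= h; apply: contrapT => hE; apply: h; exists k => n kn.
  rewrite ltNge; apply/negP => en; apply: hE; apply: (subE w (n - k)%N) => //.
  rewrite subnKC// /Y ler_wpDr// -[leRHS]real_normK ?num_real//.
  apply: lerXn2r; rewrite ?nnegrE ?normr_ge0//.
  exact: ltW.
apply: le_trans PE _; rewrite addn0 lee_fin ler_pdivrMr//.
apply: le_trans hk; rewrite le_eqVlt; apply/orP; left; apply/eqP.
by apply: eq_Rintegral => w _; rewrite /Y subrr expr0n add0r.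
Qed.

(** * Almost sure conclusions *)

Lemma total_unbounded q n0 : 0 < q ->
  (forall n, (n0 <= n)%N -> q <= Ex (B n)) ->
  {ae P, forall w, forall K : R, exists n, K < total n w}.
Proof.
move=> q0 hq.
have : {ae P, forall w, forall k : nat, exists n, k.+1%:R < total n w}.
  apply: ae_foralln => k; apply: negligible_eps => e e0.
  have [n hn] := total_bounded_unlikely q0 hq (ltr0Sn _ k) e0.
  have mA : measurable [set w | total n w <= k.+1%:R].
    apply: (@filtration_measurable n).
    by apply: bmfun_le; [exact: bmfun_total|exact: bmfun_cst].
  eexists; first exact: mA; split.
    by move=> w /= h; rewrite leNgt; apply/negP => h'; apply: h; exists n.
  by rewrite -(@fineK _ (P _)) ?lee_fin// fin_num_measure.
apply: filterS => w h K; have [n hn] := h (Num.truncn K).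
by exists n; apply: lt_trans hn; exact: truncnS_gt.
Qed.

Lemma urn_cvg q n0 : 0 < q -> (forall n, (n0 <= n)%N -> q <= Ex (B n)) ->
  exists Zlim : {RV P >-> R},
    [/\ {ae P, forall w : T, Z n w @[n --> \oo] --> Zlim w},
        {ae P, forall w : T, L w <= Zlim w <= U w} &
        {ae P, forall w : T, 0 < Zlim w < 1}].
Proof.
move=> q0 hq.
(* The limsup is defined and measurable on the whole space, and it is the limit wherever one
   exists. *)
pose Zl w := limn_sup (Z ^~ w).
have mZl : measurable_fun setT Zl.
  apply: measurable_fun_limn_sup => [w _|w _|n].
  - by exists 1 => _ [n _ <-]; have /andP[_ /ltW] := proportion_itv n w.
  - by exists 0 => _ [n _ <-]; have /andP[/ltW] := proportion_itv n w.
  - move=> _ S mS; rewrite setTI.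
    apply: (@filtration_measurable n).
    by have [mZ _ _] := X_condexp n; exact: mZ.
pose hZl := isMeasurableFun.Build _ _ _ _ Zl mZl.
pose Zlim : {RV P >-> R} := HB.pack Zl hZl.
suff all3 : {ae P, forall w, [/\ Z n w @[n --> \oo] --> Zl w,
    L w <= Zl w <= U w & 0 < Zl w < 1]}.
  by exists Zlim; split; apply: filterS all3 => w [].
have ae1 := total_unbounded q0 hq.
have ae2 := ae_foralln (interior_potential_bounded).
(* Only countably many tolerances, so that one null set serves for all of them. *)
have ae3 : {ae P, forall w, forall j : nat, exists k, forall n, (k <= n)%N ->
    `|interior_sum n w - interior_sum k w| < j.+1%:R^-1}.
  by apply: ae_foralln => j; apply: interior_sum_cauchy hq _ => //;
    rewrite invr_gt0.
apply: filterS3 ae1 ae2 ae3 => w unb pot cau.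
have [L0 LU U1] := barriers w.
have ZE : Z ^~ w = fun n => black n w / (black n w + red n w).
  by apply/funext => n; rewrite proportionE.
rewrite /Zl ZE.
apply: (@urn_path_cvg R c (L w) (U w) (black ^~ w) (red ^~ w) c_ge0 L0 LU U1
  (b0 w) (r0 w) (urn_step w) unb (interior_sum ^~ w)).
- move=> n; rewrite -!proportionE => int; exact: interior_sumS.
- move=> e e0; have [k hk] := cau (Num.truncn (2 / e)).
  exists k => n p /hk hn /hk hp.
  have he : (Num.truncn (2 / e)).+1%:R^-1 < e / 2.
    by rewrite -[ltRHS]invrK ltf_pV2 ?posrE ?invr_gt0 ?divr_gt0// invf_div truncnS_gt.
  rewrite [ltRHS]splitr (le_lt_trans (ler_distD (interior_sum k w) _ _))//.
  by rewrite ltrD ?(lt_trans hn he)// distrC (lt_trans hp he).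
- move=> k int; apply: pot => n kn; have := int n kn.
  by rewrite -proportionE.
Qed.

End urn.

Lemma limn_einf_expectation_gt0 d (T : measurableType d) (R : realType)
    (P : probability T R) (B : nat -> {RV P >-> R}) (c : R) :
  (forall (n : nat) (w : T), (0 < n)%N -> 0 <= B n w <= c) ->
  (0 < limn_einf (fun n : nat => 'E_P[B n]))%E ->
  exists q n0, 0 < q /\ forall n, (n0 <= n)%N -> q <= Rintegral P setT (B n).
Proof.
move=> B_bnd; set u := fun n => _; rewrite limn_einf_lim => lim0.
have [n1 hn1] : exists n, (0 < einfs u n)%E.
  apply: contrapT => h; move: lim0; rewrite ltNge => /negP; apply.
  apply: lime_le; first exact: is_cvg_einfs.
  by apply: nearW => n; rewrite leNgt; apply/negP => hn; apply: h; exists n.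
have uE n : (0 < n)%N -> u n = (Rintegral P setT (B n))%:E.
  move=> n0; rewrite /u unlock /Rintegral fineK//.
  apply: integrable_fin_num => //; apply: bmfun_integrable; split.
    move=> _ S mS; apply: sub_sigma_algebra.
    exact: (measurable_funPT (B n) measurableT _ mS).
  by exists c => w; have /andP[? ?] := B_bnd n w n0; rewrite ger0_norm.
have le_u n : (n1 <= n)%N -> (einfs u n1 <= u n)%E.
  by move=> n1n; apply: ereal_inf_lbound; exists n.
have := le_u n1.+1 (leqnSn _); rewrite uE// => fin1.
have e_fin : einfs u n1 \is a fin_num.
  by rewrite ge0_fin_numE ?ltW// (le_lt_trans fin1) ?ltry.
(* The infimum over a tail is the lower bound; starting at [n1.+1] avoids index 0, where [B_bnd]
   says nothing. *)
exists (fine (einfs u n1)), n1.+1; split.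
  by rewrite fine_gt0// hn1 -ge0_fin_numE ?ltW.
move=> n n1n; rewrite -lee_fin fineK// -uE; first exact: le_u (ltnW n1n).
exact: leq_ltn_trans n1n.
Qed.

Theorem theorem1 (d : measure_display) (T : measurableType d) (R : realType)
    (P : probability T R) (b r c : R) (L U : {RV P >-> R})
    (X B Rd : nat -> {RV P >-> R}) (Z : nat -> T -> R)
    (b_gt0 : 0 < b) (r_gt0 : 0 < r)
    (barriers : forall w : T, [/\ 0 <= L w, L w < U w & U w <= 1])
    (X01 : forall (n : nat) (w : T), (0 < n)%N -> X n w = 0 \/ X n w = 1)
    (B_bnd : forall (n : nat) (w : T), (0 < n)%N -> 0 <= B n w <= c)
    (Rd_bnd : forall (n : nat) (w : T), (0 < n)%N -> 0 <= Rd n w <= c)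
    (Z_rec : urn_proportion b r L U X B Rd Z)
    (X_condexp : forall n : nat,
      is_cond_exp P (urn_filtration L U X B Rd n) (X n.+1) (Z n))
    (BR_indep : forall n : nat, (0 < n)%N ->
      indep_sigma P (sigma_rv [set (B n : T -> R); (Rd n : T -> R)])
        (sigma_join (urn_filtration L U X B Rd n.-1)
                    (sigma_rv [set (X n : T -> R)])))
    (RdB : forall (n : nat) (w : T), (0 < n)%N -> Rd n w = B n w)
    (liminf_EB : (0 < limn_einf (fun n : nat => 'E_P[B n]))%E) :
  exists Zlim : {RV P >-> R},
    [/\ {ae P, forall w : T, Z n w @[n --> \oo] --> Zlim w},
        {ae P, forall w : T, L w <= Zlim w <= U w} &
        {ae P, forall w : T, 0 < Zlim w < 1}].
Proof.
have [q [n0 [q0 hq]]] := limn_einf_expectation_gt0 B_bnd liminf_EB.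
exact: (urn_cvg b_gt0 r_gt0 barriers X01 B_bnd Z_rec X_condexp BR_indep RdB
  q0 hq).
Qed.
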